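(* There are $88$ simple left $D$-modules up to isomorphism, among which $32$ are one-dimensional, namely the modules $\mathbb{k}_{\chi_{i,j,k,l}}$ ($0\le i,k,l<2$, $0\le j<4$), and $56$ are two-dimensional, namely the modules $V_{i,j,k,l,m,n}$ with $(i,j,k,l,m,n)\in\Omega$, $W_{i,j,k,l}$ with $(i,j,k,l)\in\Lambda^1$, and $U_{i,j,k,l}$ with $(i,j,k,l)\in\Lambda^2$.
   Context: $\mathbb{k}$ is an algebraically closed field of characteristic $0$, $\xi\in\mathbb{k}$ a primitive 4th root of unity. $H=H_{b:1}$ is the 16-dimensional Hopf algebra generated by $x,y,t$ with relations $x^4=y^2=t^2=1$, $xy=yx$, $tx=x^{-1}t$, $ty=yt$ and $\Delta(x)=x\otimes x$, $\Delta(y)=y\otimes y$, $\Delta(t)=\frac12[(1+y)t\otimes t+(1-y)t\otimes x^2t]$, $\varepsilon(x)=\varepsilon(y)=\varepsilon(t)=1$. $D=D(H^{cop})$ is the Drinfeld double of $H^{cop}$; as an algebra it is presented by generators $a,b,c,d,x,y,t$ with relations: $x^4=y^2=t^2=1$, $xy=yx$, $tx=x^{-1}t$, $ty=yt$; $a^2=b^2=c^2=1$, $a,b,c$ commute pairwise, $d^2=a$, $da=ad$, $db=cd$, $dc=bd$; $xa=ax$, $xb=bx$, $xc=cx$, $xd=bcdx$; $ya=ay$, $yb=by$, $yc=cy$, $yd=dy$; $ta=at$, $tb=bx^2t$, $tc=cx^2t$, $td=adyt$. One-dimensional modules: $\mathbb{k}_{\chi_{i,j,k,l}}$ is given by the character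 $\chi(x)=(-1)^i$, $\chi(y)=(-1)^j$, $\chi(t)=(-1)^k$, $\chi(a)=(-1)^j$, $\chi(b)=\chi(c)=(-1)^l$, $\chi(d)=\xi^j$. Index sets: $\Omega=\Omega^1\cup\Omega^2$, $\Omega^1=\{(0,j,k,l,m,n)\mid j,k,l,m,n\in\mathbb{Z}_2,\ m+n=1\}$, $\Omega^2=\{(i,j,0,l,m,n)\mid i,j,l,m,n\in\mathbb{Z}_2,\ m+n=0,\ j+l=1\}$, $\Lambda^1=\{(1,j,k,l)\mid k\in\mathbb{Z}_4,\ j,l\in\mathbb{Z}_2\}$, $\Lambda^2=\{(1,j,k,l)\mid j\in\mathbb{Z}_4,\ k,l\in\mathbb{Z}_2\}$. Two-dimensional modules (matrices in a fixed basis $v_1,v_2$, columns being the images of basis vectors): $V_{i,j,k,l,m,n}$: $x=\mathrm{diag}((-1)^i,(-1)^{i+m+n})$, $y=(-1)^j\mathrm{Id}$, $t=\mathrm{diag}((-1)^k,(-1)^{j+l+k})$, $a=(-1)^l\mathrm{Id}$, $b=\mathrm{diag}((-1)^m,(-1)^n)$, $c=\mathrm{diag}((-1)^n,(-1)^m)$, $d=\begin{pmatrix}0&1\\(-1)^l&0\end{pmatrix}$. $W_{i,j,k,l}$: $x=\mathrm{diag}(\xi,\xi^{-1})$, $y=(-1)^j\mathrm{Id}$, $t=\begin{pmatrix}0&1\\1&0\end{pmatrix}$, $a=(-1)^k\mathrm{Id}$, $b=c=\mathrm{diag}((-1)^l,(-1)^{l+1})$, $d=\mathrm{diag}(\xi^k,(-1)^{j+k}\xi^k)$.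 $U_{i,j,k,l}$: $x=\mathrm{diag}(\xi,\xi^{-1})$, $y=(-1)^j\mathrm{Id}$, $t=\begin{pmatrix}0&1\\1&0\end{pmatrix}$, $a=(-1)^k\mathrm{Id}$, $b=\mathrm{diag}((-1)^l,(-1)^{l+1})$, $c=\mathrm{diag}((-1)^{l+1},(-1)^{l})$, $d=\begin{pmatrix}0&\xi^j\\(-1)^{j+k}\xi^j&0\end{pmatrix}$. *)

(* Defs.v *)
From HB Require Import structures.
From mathcomp Require Import all_boot all_order all_algebra.
From mathcomp Require Import boolp ring.

Set Implicit Arguments.
Unset Strict Implicit.
Unset Printing Implicit Defensive.

Import GRing.Theory.
Local Open Scope ring_scope.
Local Open Scope quotient_scope.

(* The k-algebra presented by a type [gen] of generators and a list [rels] of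
   relations u = v between words u, v in the generators. It is the quotient of
   the noncommutative polynomial expressions over k by the smallest congruence
   containing the axioms of (unital, associative) k-algebras and [rels]. *)

Section Presentation.

Variables (k : fieldType) (gen : eqType) (rels : seq (seq gen * seq gen)).

Inductive pterm : Type :=
  | PVar of gen
  | PCst of k
  | PAdd of pterm & pterm
  | PMul of pterm & pterm.

HB.instance Definition _ := gen_eqMixin pterm.
HB.instance Definition _ := gen_choiceMixin pterm.

Definition pword (w : seq gen) : pterm :=
  foldr (fun g t => PMul (PVar g) t) (PCst 1) w.

Inductive pcong : pterm -> pterm -> Prop :=
  | pcong_refl t : pcong t t
  | pcong_sym s t : pcong s t -> pcong t s
  | pcong_trans s t u : pcong s t -> pcong t u -> pcong s u
  | pcong_add s s' t t' :
      pcong s s' -> pcong t t' -> pcong (PAdd s t) (PAdd s' t')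
  | pcong_mul s s' t t' :
      pcong s s' -> pcong t t' -> pcong (PMul s t) (PMul s' t')
  | pcong_addA s t u : pcong (PAdd s (PAdd t u)) (PAdd (PAdd s t) u)
  | pcong_addC s t : pcong (PAdd s t) (PAdd t s)
  | pcong_add0 t : pcong (PAdd (PCst 0) t) t
  | pcong_addN t : pcong (PAdd (PMul (PCst (-1)) t) t) (PCst 0)
  | pcong_mulA s t u : pcong (PMul s (PMul t u)) (PMul (PMul s t) u)
  | pcong_mul1l t : pcong (PMul (PCst 1) t) t
  | pcong_mulDl s t u :
      pcong (PMul (PAdd s t) u) (PAdd (PMul s u) (PMul t u))
  | pcong_mulDr s t u :
      pcong (PMul s (PAdd t u)) (PAdd (PMul s t) (PMul s u))
  | pcong_cstD a b : pcong (PCst (a + b)) (PAdd (PCst a) (PCst b))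
  | pcong_cstM a b : pcong (PCst (a * b)) (PMul (PCst a) (PCst b))
  | pcong_cstC a t : pcong (PMul (PCst a) t) (PMul t (PCst a))
  | pcong_rel r : r \in rels -> pcong (pword r.1) (pword r.2).

Definition pcongb (s t : pterm) : bool := `[< pcong s t >].

Lemma pcongb_refl : reflexive pcongb.
Proof. by move=> t; apply/asboolP; apply: pcong_refl. Qed.

Lemma pcongb_sym : symmetric pcongb.
Proof.
by move=> s t; apply/asboolP/asboolP; apply: pcong_sym.
Qed.

Lemma pcongb_trans : transitive pcongb.
Proof.
move=> t s u /asboolP st /asboolP tu.
by apply/asboolP; apply: pcong_trans st tu.
Qed.

Canonical pcong_equiv := EquivRel pcongb pcongb_refl pcongb_sym pcongb_trans.

Definition palg : Type := {eq_quot pcong_equiv}.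

HB.instance Definition _ := Choice.on palg.

Definition pcls (t : pterm) : palg := \pi_({eq_quot pcong_equiv}) t.
Definition prep (u : palg) : pterm := @repr _ {eq_quot pcong_equiv} u.

Lemma prepK u : pcls (prep u) = u.
Proof. exact: (@reprK _ {eq_quot pcong_equiv}). Qed.

Lemma pclsP s t : pcls s = pcls t <-> pcong s t.
Proof.
split=> [/eqmodP /asboolP //|st].
by apply/eqmodP/asboolP.
Qed.

Lemma prep_cls t : pcong (prep (pcls t)) t.
Proof. by apply/pclsP; rewrite prepK. Qed.

Definition padd (u v : palg) : palg := pcls (PAdd (prep u) (prep v)).
Definition pmul (u v : palg) : palg := pcls (PMul (prep u) (prep v)).
Definition pscale (c : k) (u : palg) : palg := pcls (PMul (PCst c) (prep u)).
Definition popp (u : palg) : palg := pscale (-1) u.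

Lemma pcls_add s t : padd (pcls s) (pcls t) = pcls (PAdd s t).
Proof. by apply/pclsP; apply: pcong_add; apply: prep_cls. Qed.

Lemma pcls_mul s t : pmul (pcls s) (pcls t) = pcls (PMul s t).
Proof. by apply/pclsP; apply: pcong_mul; apply: prep_cls. Qed.

Lemma pcls_scale c t : pscale c (pcls t) = pcls (PMul (PCst c) t).
Proof.
by apply/pclsP; apply: pcong_mul; [apply: pcong_refl | apply: prep_cls].
Qed.

Lemma pcls_ind (P : palg -> Prop) : (forall t, P (pcls t)) -> forall u, P u.
Proof. by move=> Pt u; rewrite -(prepK u). Qed.

Lemma paddA : associative padd.
Proof.
do 3![elim/pcls_ind => ?]; rewrite !pcls_add.
exact/pclsP/pcong_addA.
Qed.

Lemma paddC : commutative padd.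
Proof. by do 2![elim/pcls_ind => ?]; rewrite !pcls_add; exact/pclsP/pcong_addC. Qed.

Lemma padd0 : left_id (pcls (PCst 0)) padd.
Proof. by elim/pcls_ind => ?; rewrite !pcls_add; exact/pclsP/pcong_add0. Qed.

Lemma paddN : left_inverse (pcls (PCst 0)) popp padd.
Proof.
by elim/pcls_ind => ?; rewrite /popp pcls_scale pcls_add; exact/pclsP/pcong_addN.
Qed.

HB.instance Definition _ :=
  GRing.isZmodule.Build palg paddA paddC padd0 paddN.

Lemma pmulA : associative pmul.
Proof.
do 3![elim/pcls_ind => ?]; rewrite !pcls_mul.
exact/pclsP/pcong_mulA.
Qed.

Lemma pmul1l : left_id (pcls (PCst 1)) pmul.
Proof. by elim/pcls_ind => ?; rewrite pcls_mul; exact/pclsP/pcong_mul1l. Qed.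

Lemma pmul1r : right_id (pcls (PCst 1)) pmul.
Proof.
elim/pcls_ind => t; rewrite pcls_mul; apply/pclsP.
by apply: pcong_trans (pcong_mul1l t); apply/pcong_sym/pcong_cstC.
Qed.

Lemma pmulDl : left_distributive pmul padd.
Proof.
do 3![elim/pcls_ind => ?]; rewrite !(pcls_mul, pcls_add).
exact/pclsP/pcong_mulDl.
Qed.

Lemma pmulDr : right_distributive pmul padd.
Proof.
do 3![elim/pcls_ind => ?]; rewrite !(pcls_mul, pcls_add).
exact/pclsP/pcong_mulDr.
Qed.

HB.instance Definition _ :=
  GRing.Zmodule_isPzRing.Build palg pmulA pmul1l pmul1r pmulDl pmulDr.

Lemma pscaleE c u : pscale c u = pcls (PCst c) * u.
Proof. by elim/pcls_ind: u => t; rewrite pcls_scale -pcls_mul. Qed.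

Lemma pcstD : {morph (fun c => pcls (PCst c)) : a b / a + b}.
Proof.
move=> a b; rewrite -[RHS]/(padd _ _) pcls_add; exact/pclsP/pcong_cstD.
Qed.

Lemma pcstM : {morph (fun c => pcls (PCst c)) : a b / a * b}.
Proof.
move=> a b; rewrite -[RHS]/(pmul _ _) pcls_mul; exact/pclsP/pcong_cstM.
Qed.

Lemma pcstC c u : pcls (PCst c) * u = u * pcls (PCst c).
Proof.
elim/pcls_ind: u => t; rewrite -[LHS]/(pmul _ _) -[RHS]/(pmul _ _) !pcls_mul.
exact/pclsP/pcong_cstC.
Qed.

Lemma pscaleA a b v : pscale a (pscale b v) = pscale (a * b) v.
Proof. by rewrite !pscaleE pcstM mulrA. Qed.

Lemma pscale1 : left_id 1 pscale.
Proof. by move=> v; rewrite pscaleE; apply: mul1r. Qed.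

Lemma pscaleDr : right_distributive pscale +%R.
Proof. by move=> c u v; rewrite !pscaleE mulrDr. Qed.

Lemma pscaleDl v : {morph pscale^~ v : a b / a + b}.
Proof. by move=> a b; rewrite !pscaleE pcstD mulrDl. Qed.

HB.instance Definition _ :=
  GRing.Zmodule_isLmodule.Build k palg pscaleA pscale1 pscaleDr pscaleDl.

Definition pvar (g : gen) : palg := pcls (PVar g).

(* A family of elements of a k-algebra satisfying the relations. *)
Definition satisfies (B : pzRingType) (f : gen -> B) : bool :=
  all (fun r : seq gen * seq gen =>
         \prod_(g <- r.1) f g == \prod_(g <- r.2) f g) rels.

Fixpoint peval (B : algType k) (f : gen -> B) (t : pterm) : B :=
  match t with
  | PVar g => f g
  | PCst c => c%:A
  | PAdd s u => peval f s + peval f u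
  | PMul s u => peval f s * peval f u
  end.

Lemma peval_word (B : algType k) (f : gen -> B) w :
  peval f (pword w) = \prod_(g <- w) f g.
Proof.
elim: w => [|g w IH] /=; first by rewrite big_nil scale1r.
by rewrite big_cons IH.
Qed.

Lemma peval_cong (B : algType k) (f : gen -> B) : satisfies f ->
  forall s t, pcong s t -> peval f s = peval f t.
Proof.
move=> fP s t; elim=> {s t} //=.
- by move=> s t u _ -> _ ->.
- by move=> s s' t t' _ -> _ ->.
- by move=> s s' t t' _ -> _ ->.
- by move=> *; rewrite addrA.
- by move=> *; rewrite addrC.
- by move=> *; rewrite scale0r add0r.
- by move=> t; rewrite scaleN1r mulN1r addNr scale0r.
- by move=> *; rewrite mulrA.
- by move=> *; rewrite scale1r mul1r.
- by move=> *; rewrite mulrDl.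
- by move=> *; rewrite mulrDr.
- by move=> *; rewrite scalerDl.
- by move=> *; rewrite -scalerAl mul1r scalerA.
- by move=> *; rewrite -scalerAl -scalerAr mul1r mulr1.
- by move=> r r_in; rewrite !peval_word; apply/eqP/(allP fP).
Qed.

Lemma palg_neq0 : (1 : palg) != 0.
Proof.
apply/eqP => /pclsP.
have triv : satisfies (fun _ : gen => 1 : k^o).
  by apply/allP => r _; rewrite !big1.
move/(peval_cong triv) => /= /eqP.
by rewrite scale0r scale1r oner_eq0.
Qed.

HB.instance Definition _ := GRing.PzSemiRing_isNonZero.Build palg palg_neq0.

Lemma palg_scalerAl c (u v : palg) : c *: (u * v) = (c *: u) * v.
Proof.
rewrite -[LHS]/(pscale _ _) -[c *: u]/(pscale _ _) !pscaleE.
exact: mulrA.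
Qed.

HB.instance Definition _ :=
  GRing.Lmodule_isLalgebra.Build k palg palg_scalerAl.

Lemma palg_scalerAr c (u v : palg) : c *: (u * v) = u * (c *: v).
Proof.
rewrite -[LHS]/(pscale _ _) -[c *: v]/(pscale _ _) !pscaleE.
by rewrite mulrA pcstC mulrA.
Qed.

HB.instance Definition _ :=
  GRing.Lalgebra_isAlgebra.Build k palg palg_scalerAr.

(* The universal property: a family satisfying the relations extends to an
   algebra morphism (uniquely, see [plift_uniq]). *)

Section Lift.

Variables (B : algType k) (f : gen -> B) (fP : satisfies f).

Definition plift of satisfies f := fun u : palg => peval f (prep u).

Lemma plift_cls t : plift fP (pcls t) = peval f t.
Proof. exact: (peval_cong fP (prep_cls t)). Qed.

Lemma plift_var g : plift fP (pvar g) = f g.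
Proof. exact: plift_cls. Qed.

Lemma pliftD : {morph plift fP : u v / u + v}.
Proof.
do 2![elim/pcls_ind => ?].
by rewrite -[_ + _ in LHS]/(padd _ _) pcls_add !plift_cls.
Qed.

Lemma plift0 : plift fP 0 = 0.
Proof. by rewrite [LHS]plift_cls /= scale0r. Qed.

Lemma pliftM : {morph plift fP : u v / u * v}.
Proof.
do 2![elim/pcls_ind => ?].
by rewrite -[_ * _ in LHS]/(pmul _ _) pcls_mul !plift_cls.
Qed.

Lemma plift1 : plift fP 1 = 1.
Proof. by rewrite [LHS]plift_cls /= scale1r. Qed.

Lemma pliftZ : scalable (plift fP).
Proof.
move=> c; elim/pcls_ind => t.
rewrite -[_ *: _ in LHS]/(pscale _ _) pcls_scale !plift_cls /=.
by rewrite -scalerAl mul1r.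
Qed.

HB.instance Definition _ :=
  GRing.isNmodMorphism.Build palg B (plift fP) (conj plift0 pliftD).
HB.instance Definition _ :=
  GRing.isMonoidMorphism.Build palg B (plift fP) (conj plift1 pliftM).
HB.instance Definition _ :=
  GRing.isScalable.Build k palg B *:%R (plift fP) pliftZ.

Lemma plift_uniq (h : {lrmorphism palg -> B}) :
  (forall g, h (pvar g) = f g) -> h =1 plift fP.
Proof.
move=> hf; elim/pcls_ind=> t; rewrite plift_cls.
elim: t => [g|c|s IHs t IHt|s IHs t IHt] /=; first exact: hf.
- rewrite -(rmorph1 h) -linearZ; congr (h _).
  by rewrite -[RHS]/(pscale _ _) pscaleE mulr1.
- by rewrite -pcls_add -IHs -IHt -rmorphD.
- by rewrite -pcls_mul -IHs -IHt -rmorphM.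
Qed.

End Lift.

Lemma pvar_satisfies : satisfies pvar.
Proof.
have wE w : pcls (pword w) = \prod_(g <- w) pvar g.
  elim: w => [|g w IH] /=; first by rewrite big_nil.
  by rewrite big_cons -IH -pcls_mul.
by apply/allP => r r_in; rewrite -!wE; apply/eqP/pclsP/pcong_rel.
Qed.

(* Column vectors, with the generators acting by left multiplication by given
   square matrices: column j of [f g] is the image of the j-th basis vector. *)

Section MatrixModule.

Variables (n : nat) (f : gen -> 'M[k]_n.+1).

Definition mxmod of satisfies f : Type := 'cV[k]_n.+1.

Variable fP : satisfies f.

HB.instance Definition _ := GRing.Zmodule.on (mxmod fP).

Definition mxact (u : palg) (v : mxmod fP) : mxmod fP := plift fP u *m v.

Lemma mxactA u u' v : mxact u (mxact u' v) = mxact (u * u') v.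
Proof. by rewrite /mxact rmorphM mulmxA. Qed.

Lemma mxact1 : left_id 1 mxact.
Proof. by move=> v; rewrite /mxact rmorph1 mul1mx. Qed.

Lemma mxactDr : right_distributive mxact +%R.
Proof. by move=> u v w; rewrite /mxact mulmxDr. Qed.

Lemma mxactDl v : {morph mxact^~ v : u u' / u + u'}.
Proof. by move=> u u'; rewrite /mxact rmorphD mulmxDl. Qed.

HB.instance Definition _ :=
  GRing.Zmodule_isLmodule.Build palg (mxmod fP) mxactA mxact1 mxactDr mxactDl.

End MatrixModule.

End Presentation.

Section Modules.

Variables (k : fieldType) (A : algType k).

Definition simple_module (M : lmodType A) : Prop :=
  (exists v : M, v != 0) /\
  (forall S : {pred M}, submod_closed S ->
     (forall v, v \in S -> v = 0) \/ (forall v, v \in S)).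

Definition module_iso (M N : lmodType A) : Prop :=
  exists f : {linear M -> N}, bijective f.

(* k acts on an A-module through c |-> c%:A; [e] is a k-basis of M. *)
Definition has_dim (n : nat) (M : lmodType A) : Prop :=
  exists e : 'I_n -> M,
    bijective (fun c : 'rV[k]_n => \sum_(i < n) (c 0 i)%:A *: e i).

(* The modules M i, for i : I, are pairwise non-isomorphic and represent all
   the isomorphism classes of A-modules satisfying P. *)
Definition classification (P : lmodType A -> Prop) (I : finType)
    (M : I -> lmodType A) : Prop :=
  [/\ forall i, P (M i),
      forall i j, module_iso (M i) (M j) -> i = j
    & forall N, P N -> exists i, module_iso N (M i)].

End Modules.

(* D = D(H_{b:1}^cop), as an algebra; since x has order 4, the word xxx stands
   for x^-1. *)

Inductive Dgen : Type := Da | Db | Dc | Dd | Dx | Dy | Dt.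

HB.instance Definition _ := gen_eqMixin Dgen.

Definition Drels : seq (seq Dgen * seq Dgen) :=
  [:: ([:: Dx; Dx; Dx; Dx], [::]); ([:: Dy; Dy], [::]); ([:: Dt; Dt], [::]);
      ([:: Dx; Dy], [:: Dy; Dx]); ([:: Dt; Dx], [:: Dx; Dx; Dx; Dt]);
      ([:: Dt; Dy], [:: Dy; Dt]);
      ([:: Da; Da], [::]); ([:: Db; Db], [::]); ([:: Dc; Dc], [::]);
      ([:: Da; Db], [:: Db; Da]); ([:: Da; Dc], [:: Dc; Da]);
      ([:: Db; Dc], [:: Dc; Db]);
      ([:: Dd; Dd], [:: Da]); ([:: Dd; Da], [:: Da; Dd]);
      ([:: Dd; Db], [:: Dc; Dd]); ([:: Dd; Dc], [:: Db; Dd]);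
      ([:: Dx; Da], [:: Da; Dx]); ([:: Dx; Db], [:: Db; Dx]);
      ([:: Dx; Dc], [:: Dc; Dx]); ([:: Dx; Dd], [:: Db; Dc; Dd; Dx]);
      ([:: Dy; Da], [:: Da; Dy]); ([:: Dy; Db], [:: Db; Dy]);
      ([:: Dy; Dc], [:: Dc; Dy]); ([:: Dy; Dd], [:: Dd; Dy]);
      ([:: Dt; Da], [:: Da; Dt]); ([:: Dt; Db], [:: Db; Dx; Dx; Dt]);
      ([:: Dt; Dc], [:: Dc; Dx; Dx; Dt]);
      ([:: Dt; Dd], [:: Da; Dd; Dy; Dt])].

Definition Dalg (k : fieldType) : algType k := palg k Drels.

Definition mx2 (R : Type) (p q r s : R) : 'M[R]_2 :=
  \matrix_(i < 2, j < 2)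
    (if i == 0 :> nat then if j == 0 :> nat then p else q
     else if j == 0 :> nat then r else s).

Definition Omega1 : {set 'Z_2 * 'Z_2 * 'Z_2 * 'Z_2 * 'Z_2 * 'Z_2} :=
  [set w | let: (i, j, k, l, m, n) := w in (i == 0) && (m + n == 1)].
Definition Omega2 : {set 'Z_2 * 'Z_2 * 'Z_2 * 'Z_2 * 'Z_2 * 'Z_2} :=
  [set w | let: (i, j, k, l, m, n) := w in
           [&& k == 0, m + n == 0 & j + l == 1]].
Definition Omega := Omega1 :|: Omega2.
Definition Lambda1 : {set 'Z_2 * 'Z_2 * 'Z_4 * 'Z_2} :=
  [set w | let: (i, j, k, l) := w in i == 1].
Definition Lambda2 : {set 'Z_2 * 'Z_4 * 'Z_2 * 'Z_2} :=
  [set w | let: (i, j, k, l) := w in i == 1].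

Section SimpleModules.

(* In exponents, elements of 'Z_2 and 'Z_4 are read as the naturals
   0, 1 and 0, 1, 2, 3 and added as naturals. *)

Variables (K : fieldType) (xi : K).

Definition chi_mx (i : 'Z_2) (j : 'Z_4) (k l : 'Z_2) (g : Dgen) : 'M[K]_1 :=
  match g with
  | Dx => ((-1) ^+ i)%:M
  | Dy => ((-1) ^+ j)%:M
  | Dt => ((-1) ^+ k)%:M
  | Da => ((-1) ^+ j)%:M
  | Db | Dc => ((-1) ^+ l)%:M
  | Dd => (xi ^+ j)%:M
  end.

Definition V_mx (i j k l m n : 'Z_2) (g : Dgen) : 'M[K]_2 :=
  match g with
  | Dx => mx2 ((-1) ^+ i) 0 0 ((-1) ^+ (i + m + n)%N)
  | Dy => ((-1) ^+ j)%:M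
  | Dt => mx2 ((-1) ^+ k) 0 0 ((-1) ^+ (j + l + k)%N)
  | Da => ((-1) ^+ l)%:M
  | Db => mx2 ((-1) ^+ m) 0 0 ((-1) ^+ n)
  | Dc => mx2 ((-1) ^+ n) 0 0 ((-1) ^+ m)
  | Dd => mx2 0 1 ((-1) ^+ l) 0
  end.

Definition W_mx (i j : 'Z_2) (k : 'Z_4) (l : 'Z_2) (g : Dgen) : 'M[K]_2 :=
  match g with
  | Dx => mx2 xi 0 0 xi^-1
  | Dy => ((-1) ^+ j)%:M
  | Dt => mx2 0 1 1 0
  | Da => ((-1) ^+ k)%:M
  | Db | Dc => mx2 ((-1) ^+ l) 0 0 ((-1) ^+ l.+1)
  | Dd => mx2 (xi ^+ k) 0 0 ((-1) ^+ (j + k)%N * xi ^+ k)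
  end.

Definition U_mx (i : 'Z_2) (j : 'Z_4) (k l : 'Z_2) (g : Dgen) : 'M[K]_2 :=
  match g with
  | Dx => mx2 xi 0 0 xi^-1
  | Dy => ((-1) ^+ j)%:M
  | Dt => mx2 0 1 1 0
  | Da => ((-1) ^+ k)%:M
  | Db => mx2 ((-1) ^+ l) 0 0 ((-1) ^+ l.+1)
  | Dc => mx2 ((-1) ^+ l.+1) 0 0 ((-1) ^+ l)
  | Dd => mx2 0 (xi ^+ j) ((-1) ^+ (j + k)%N * xi ^+ j) 0
  end.

Lemma mx2M (p q r s p' q' r' s' : K) :
  mx2 p q r s * mx2 p' q' r' s' =
  mx2 (p * p' + q * r') (p * q' + q * s') (r * p' + s * r') (r * q' + s * s').
Proof.
by apply/matrixP => i j; rewrite !mxE !big_ord_recl big_ord0 !mxE /= addr0;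
  case: i j => [[|[|?]] ?] // [[|[|?]] ?].
Qed.

Lemma scalar_mx2 (p : K) : p%:M = mx2 p 0 0 p.
Proof.
by apply/matrixP => i j; rewrite !mxE;
  case: i j => [[|[|?]] ?] // [[|[|?]] ?].
Qed.

Lemma mx2_1 : 1 = mx2 1 0 0 1 :> 'M[K]_2.
Proof. exact: scalar_mx2. Qed.

Lemma sign_cases (p : nat) : (-1) ^+ p = 1 :> K \/ (-1) ^+ p = -1 :> K.
Proof. by rewrite -signr_odd; case: (odd p); [right | left]. Qed.

Local Ltac set_sign n :=
  let p := fresh "p" in let H := fresh "H" in
  have H := sign_cases n; set p := (-1) ^+ n in H *; clearbody p.

Local Ltac case_signs :=
  repeat match goal with
  | H : ?p = 1 \/ ?p = -1 |- context [?p] =>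
      destruct H; subst p
  end.

Local Ltac mx_relations :=
  rewrite /satisfies /= !big_cons !big_nil /= !mulr1 ?(scalar_mx2, mx2_1);
  rewrite ?exprD ?exprS.

Local Ltac entrywise :=
  repeat (apply/andP; split); try (by []);
  apply/eqP; rewrite ?mx2M; congr mx2; try ring.

Lemma V_satisfies i j k l m n : satisfies Drels (V_mx i j k l m n).
Proof.
mx_relations.
set_sign i; set_sign j; set_sign k; set_sign l; set_sign m; set_sign n.
entrywise.
all: (case_signs; ring).
Qed.

Hypothesis xiP : 4.-primitive_root xi.

Lemma xi_sqr : xi * xi = -1.
Proof.
have := prim_expr_order xiP; rewrite (exprM xi 2 2) => /eqP.
rewrite sqrf_eq1 => /orP[|/eqP <- //]; rewrite -(prim_order_dvd xiP) //.
Qed.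

Lemma xi_inv : xi^-1 = - xi.
Proof.
have xi0 : xi != 0.
  by apply/eqP => xi0; have := xi_sqr; rewrite xi0 mul0r => /eqP;
     rewrite eq_sym oppr_eq0 oner_eq0.
by apply: (mulfI xi0); rewrite mulfV // mulrN xi_sqr opprK.
Qed.

Lemma xi_pow_sqr (p : nat) : xi ^+ p * xi ^+ p = (-1) ^+ p.
Proof. by rewrite -exprMn xi_sqr. Qed.

Lemma chi_satisfies i j k l : satisfies Drels (chi_mx i j k l).
Proof.
have MM (p q : K) : p%:M * q%:M = (p * q)%:M :> 'M_1.
  by rewrite -[LHS]/(_ *m _) -scalar_mxM.
have M1 : 1 = 1%:M :> 'M[K]_1 by [].
have qq := xi_pow_sqr j; move: qq.
rewrite /satisfies /= !big_cons !big_nil /= !mulr1 !(MM, M1).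
set q := xi ^+ j; clearbody q.
set_sign i; set_sign j; set_sign k; set_sign l => qq.
repeat (apply/andP; split); try by [].
all: apply/eqP; congr (_%:M); try ring.
all: case_signs; first [ring | exact: qq].
Qed.

Lemma W_satisfies i j k l : satisfies Drels (W_mx i j k l).
Proof.
have xx := xi_sqr; have qq := xi_pow_sqr k; move: qq.
mx_relations; rewrite ?xi_inv.
set q := xi ^+ k; clearbody q; set_sign j; set_sign k; set_sign l => qq.
entrywise.
all: case_signs; try ring.
all: by rewrite !(mul0r, mulr0, mul1r, mulr1, mulN1r, mulrN, mulNr, opprK,
  oppr0, add0r, addr0, xx, qq).
Qed.

Lemma U_satisfies i j k l : satisfies Drels (U_mx i j k l).
Proof.
have xx := xi_sqr; have qq := xi_pow_sqr j; move: qq.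
mx_relations; rewrite ?xi_inv.
set q := xi ^+ j; clearbody q; set_sign j; set_sign k; set_sign l => qq.
entrywise.
all: case_signs; try ring.
all: by rewrite !(mul0r, mulr0, mul1r, mulr1, mulN1r, mulrN, mulNr, opprK,
  oppr0, add0r, addr0, xx, qq).
Qed.

Definition chi_module i j k l : lmodType (Dalg K) :=
  mxmod (chi_satisfies i j k l).
Definition V_module i j k l m n : lmodType (Dalg K) :=
  mxmod (V_satisfies i j k l m n).
Definition W_module i j k l : lmodType (Dalg K) := mxmod (W_satisfies i j k l).
Definition U_module i j k l : lmodType (Dalg K) := mxmod (U_satisfies i j k l).

Definition dim1_index : finType := ('Z_2 * 'Z_4 * 'Z_2 * 'Z_2)%type.

Definition dim1_family (w : dim1_index) : lmodType (Dalg K) :=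
  let: (i, j, k, l) := w in chi_module i j k l.

Definition dim2_index : finType :=
  ({w | w \in Omega} + {w | w \in Lambda1} + {w | w \in Lambda2})%type.

Definition dim2_family (w : dim2_index) : lmodType (Dalg K) :=
  match w with
  | inl (inl w) => let: (i, j, k, l, m, n) := val w in V_module i j k l m n
  | inl (inr w) => let: (i, j, k, l) := val w in W_module i j k l
  | inr w => let: (i, j, k, l) := val w in U_module i j k l
  end.

Definition simple_index : finType := (dim1_index + dim2_index)%type.

Definition simple_family (w : simple_index) : lmodType (Dalg K) :=
  match w with
  | inl w => dim1_family w
  | inr w => dim2_family w
  end.

End SimpleModules.

(* Main.v *)
Require Import Defs.
From HB Require Import structures.
From mathcomp Require Import all_boot all_order all_algebra.
From mathcomp Require Import boolp ring.

(** Why the theorem is true.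

    In D the elements a, y, b, c, x commute pairwise, so every nonzero D-module
    contains a common eigenvector v of them ([weight_exists]).  Its eigenvalues
    (al, et, be, ga, la) are signs, except that la is a fourth root of unity.
    The generators d and t permute these weight spaces:
      d : (al, et, be, ga, la) -> (al, et, ga, be, be ga la),
      t : (al, et, be, ga, la) -> (al, et, la^2 be, la^2 ga, la^3),
    and t d = al et d t on a weight space ([weight_d], [weight_t],
    [weight_td]).  In particular x^2, bc and ya act on v, d v and t v by the
    same signs, and these three signs tell which family the module belongs to:
      x^2 = 1, bc = -1 : V with m <> n, in the basis v, d v;
      x^2 = 1, bc = 1, ya = -1 : V with m = n, in the basis v, d v;
      x^2 = 1, bc = 1, ya = 1 : a one-dimensional module, spanned by v;
      x^2 = -1, bc = 1 : W, in the basis v, t v;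
      x^2 = -1, bc = -1 : U, in the basis v, t v.
    For these vectors to span a submodule, v must in addition be an eigenvector
    of t in the two V cases, of t and d in the one-dimensional case, of d for W
    and of dt for U.  This can be arranged: the operator in question preserves
    the weight space and its square acts there by a sign ([eigen_refine]).

    The vectors found give a nonzero map from a module of the list to the given
    simple module, which Schur's lemma turns into an isomorphism ([schur],
    [iso_mxmod]), because the modules of the list are simple: in dimension two,
    one generator is diagonal with distinct eigenvalues and another one
    exchanges the two eigenlines ([mxmod2_simple]).

    To see that no two modules of the list are isomorphic it suffices to
    exhibit words in the generators that act by scalars and whose scalars
    determine the indices ([acts_as_iso]).  The words x^2, bc, ya separate the
    five cases above.  For the one-dimensional modules x, d, t, b recover the
    indices, and for V with m = n the words y, a, x, b do.  In the other cases
    bx is a scalar and, with y or a, determines all but one index; the last one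
    is read off t (for V), d (for W) or dt (for U) when ya = 1.  When ya = -1
    that operator has two opposite eigenvalues on the module; so has x, hence
    tx, dx or dtx is a scalar and can be used instead. *)

Set Implicit Arguments.
Unset Strict Implicit.
Unset Printing Implicit Defensive.

Import GRing.Theory.
Local Open Scope ring_scope.

(** The base field acts on a module over an algebra through the scalars
    [c%:A]; no separate vector space structure is put on the module. *)
Local Notation "c *k v" := (c%:A *: v) (at level 40).

(** * Modules over an algebra over a field *)

Section Modules.

Variables (K : fieldType) (A : algType K).
Implicit Types M N : lmodType A.

Lemma kscaleA M (c c' : K) (v : M) : c *k (c' *k v) = (c * c') *k v.
Proof. by rewrite scalerA -scalerAl mul1r scalerA. Qed.

Lemma kscaleC M (u : A) (c : K) (v : M) : u *: (c *k v) = c *k (u *: v).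
Proof. by rewrite !scalerA -scalerAl -scalerAr mul1r mulr1. Qed.

Lemma kscale1 M (v : M) : (1 : K) *k v = v.
Proof. by rewrite scale1r scale1r. Qed.

Lemma kscale0 M (v : M) : (0 : K) *k v = 0.
Proof. by rewrite scale0r scale0r. Qed.

Lemma kscale_inj M (v : M) (c c' : K) : v != 0 -> c *k v = c' *k v -> c = c'.
Proof.
move=> v0 /eqP; rewrite -subr_eq0 -scalerBl -scalerBl => /eqP cv.
apply/eqP; rewrite -subr_eq0; apply: contraNT v0 => c0.
by rewrite -(kscale1 v) -(mulVf c0) -kscaleA cv scaler0.
Qed.

Definition inverse_linear M N (f : {linear M -> N}) (g : N -> M)
  (fK : cancel f g) (gK : cancel g f) : {linear N -> M} :=
  HB.pack g (GRing.isLinear.Build _ _ _ _ g (can2_linear fK gK)).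

Lemma module_iso_sym M N : module_iso M N -> module_iso N M.
Proof.
case=> f [g fK gK].
by exists (inverse_linear fK gK); exists f.
Qed.

(** The hypothesis is that the map is nonzero, at the vector [v]; its kernel and
    its image are then trivial by simplicity. *)
Lemma schur M N (f : {linear M -> N}) (v : M) :
  simple_module M -> simple_module N -> f v != 0 -> module_iso N M.
Proof.
move=> [_ simM] [_ simN] fv0.
have f_inj : injective f.
  have [|ker0|kerT] := simM [pred u | f u == 0].
  - split=> [|c u w]; first by rewrite inE linear0.
    by rewrite !inE linearP => /eqP-> /eqP->; rewrite scaler0 addr0.
  - move=> u w fuw; apply/eqP; rewrite -subr_eq0; apply/eqP/ker0.
    by rewrite inE linearB fuw subrr.
  - by have := kerT v; rewrite inE (negPf fv0).
have f_surj w : exists u, f u == w.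
  have [|im0|imT] := simN [pred w | `[< exists u, f u = w >]].
  - split=> [|c w1 w2]; first by apply/asboolP; exists 0; rewrite linear0.
    move=> /asboolP[u1 <-] /asboolP[u2 <-].
    by apply/asboolP; exists (c *: u1 + u2); rewrite linearP.
  - by case/eqP: fv0; apply: im0; apply/asboolP; exists v.
  - by have /asboolP[u <-] := imT w; exists u.
pose g w := xchoose (f_surj w).
have gK : cancel g f by move=> w; apply/eqP/(xchooseP (f_surj w)).
have fK : cancel f g by move=> u; apply: f_inj; rewrite gK.
by apply: module_iso_sym; exists f; exists g.
Qed.

Definition acts_as (u : A) (c : K) M := forall v : M, u *: v = c *k v.

(** Scalars by which an algebra element acts are isomorphism invariants; this
    is how the modules of the list are told apart. *)
Lemma acts_as_iso M N u c c' :
  simple_module M -> module_iso M N ->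
  acts_as u c M -> acts_as u c' N -> c = c'.
Proof.
move=> [[v v0] _] [f f_bij] uM uN.
have fv0 : f v != 0 by rewrite -(linear0 f) (inj_eq (bij_inj f_bij)).
by apply: (kscale_inj fv0); rewrite -uN -linearZ -linearZ uM.
Qed.

Lemma has_dim_iso n M N : module_iso M N -> has_dim n M -> has_dim n N.
Proof.
case=> f f_bij [e e_bij]; exists (f \o e).
apply: (eq_bij (bij_comp f_bij e_bij)) => c /=.
by rewrite linear_sum; apply: eq_bigr => i _; rewrite linearZ.
Qed.

(** Two bases give a linear bijection between spaces of row vectors, whose
    matrix has full row rank and full column rank. *)
Lemma has_dim_uniq m n M : has_dim m M -> has_dim n M -> m = n.
Proof.
move=> [e [e' eK e'K]] [d [d' dK d'K]].
pose E p (b : 'I_p -> M) (c : 'rV[K]_p) := \sum_(i < p) c 0 i *k b i.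
have E_lin p (b : 'I_p -> M) a c c' :
    E p b (a *: c + c') = a *k E p b c + E p b c'.
  rewrite /E scaler_sumr -big_split; apply: eq_bigr => i _.
  by rewrite !mxE scalerDl scalerDl kscaleA.
have f_lin : linear (d' \o E m e).
  by move=> a c c' /=; apply: (can_inj dK); rewrite d'K E_lin
    -[in LHS](d'K (E m e c)) -[in LHS](d'K (E m e c')) [RHS]E_lin.
pose f : {linear 'rV[K]_m -> 'rV[K]_n} :=
  HB.pack (d' \o E m e) (GRing.isLinear.Build _ _ _ _ _ f_lin).
have f_bij : bijective f.
  by apply: bij_comp; [exists (E n d) | exists e'].
have fE c : f c = c *m lin1_mx f by rewrite mul_rV_lin1.
have free : row_free (lin1_mx f).
  apply/row_freeP; case: f_bij => g fK gK.
  have g_lin := can2_linear fK gK.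
  pose g' : {linear 'rV[K]_n -> 'rV[K]_m} :=
    HB.pack g (GRing.isLinear.Build _ _ _ _ _ g_lin).
  exists (lin1_mx g'); apply/row_matrixP => i.
  by rewrite row_mul rowE -fE mul_rV_lin1 /= fK row1.
have full : row_full (lin1_mx f).
  rewrite -sub1mx; apply/row_subP => i; have [g fK gK] := f_bij.
  by rewrite -(gK (row i _)) fE submxMl.
by move: free full; rewrite /row_free /row_full => /eqP-> /eqP.
Qed.

Definition ksubspace M (P : M -> Prop) :=
  forall (c : K) u v, P u -> P v -> P (c *k u + v).

Lemma eigen_ksubspace M (u : A) (c : K) :
  ksubspace (fun v : M => u *: v = c *k v).
Proof.
by move=> s v w uv uw; rewrite scalerDr kscaleC uv uw scalerDr !kscaleA mulrC.
Qed.

(** If [u] preserves a subspace and its square acts on the vector [v] of that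
    subspace as s^2, then s v + u v is an eigenvector of [u] with eigenvalue s,
    unless it vanishes, in which case u v = - s v.  *)
Lemma eigen_refine M (P : M -> Prop) (u : A) (s : K) (v : M) :
  ksubspace P -> v != 0 -> P v -> P (u *: v) -> u *: (u *: v) = (s ^+ 2) *k v ->
  exists w, [/\ w != 0, P w & exists2 d, d ^+ 2 = s ^+ 2 & u *: w = d *k w].
Proof.
move=> Psub v0 Pv Puv uuv.
have [w0|w0] := eqVneq (s *k v + u *: v) 0.
  exists v; split=> //; exists (- s); first exact: sqrrN.
  by apply/eqP; rewrite -subr_eq0 !scaleNr opprK addrC w0.
exists (s *k v + u *: v); split=> //; first exact: Psub.
exists s => //.
by rewrite scalerDr kscaleC uuv scalerDr kscaleA addrC expr2.
Qed.

End Modules.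

(** * Modules given by matrices *)

Section MatrixModules.

Variables (K : fieldType) (gen : eqType) (rels : seq (seq gen * seq gen)).
Local Notation A := (palg K rels).

Definition wact (M : lmodType A) (w : seq gen) (v : M) : M :=
  foldr (fun g v => pvar K rels g *: v) v w.

Definition wprod (w : seq gen) : A := \prod_(g <- w) pvar K rels g.

Lemma wprodE (M : lmodType A) w (v : M) : wprod w *: v = wact w v.
Proof.
rewrite /wprod; elim: w => [|g w IH]; first by rewrite big_nil scale1r.
by rewrite big_cons -scalerA IH.
Qed.

Lemma wact_rel (M : lmodType A) u w (v : M) :
  (u, w) \in rels -> wact u v = wact w v.
Proof.
move=> r_in; rewrite -!wprodE; congr (_ *: v).
exact: (eqP (allP (pvar_satisfies K rels) _ r_in)).
Qed.

(** The relation is addressed by its position in the list, because equality of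
    generators need not be computable and membership would then not reduce. *)
Lemma wact_nth_rel (M : lmodType A) p (v : M) (r := nth ([::], [::]) rels p) :
  (p < size rels)%N -> wact r.1 v = wact r.2 v.
Proof.
by move=> p_lt; apply: wact_rel; rewrite -surjective_pairing mem_nth.
Qed.

Variables (n : nat) (f : gen -> 'M[K]_n.+1) (fP : satisfies rels f).

Lemma mxmodE (u : A) (v : mxmod fP) : u *: v = plift fP u *m v.
Proof. by []. Qed.

Lemma mxmod_pvar g (v : mxmod fP) : pvar K rels g *: v = f g *m v.
Proof. by rewrite mxmodE plift_var. Qed.

Lemma mxmod_kscale (c : K) (v : mxmod fP) : c *k v = c *: (v : 'cV[K]_n.+1).
Proof. by rewrite mxmodE linearZ rmorph1 -scalemxAl mul1mx. Qed.

Lemma mxmod_acts_as w c :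
  \prod_(g <- w) f g = c%:M -> acts_as (wprod w) c (mxmod fP).
Proof.
move=> fw v; rewrite mxmod_kscale mxmodE rmorph_prod.
rewrite (eq_bigr _ (fun g _ => plift_var fP g)) fw.
exact: mul_scalar_mx.
Qed.

Lemma mxmod_has_dim : has_dim n.+1 (mxmod fP).
Proof.
exists (fun i => delta_mx i 0 : 'cV[K]_n.+1).
apply: (@eq_bij _ _ (fun c : 'rV[K]_n.+1 => c^T : mxmod fP)).
  by exists trmx => c; rewrite trmxK.
move=> c; apply/colP => i; rewrite mxE.
transitivity (\sum_(j < n.+1) (c 0 j *: delta_mx j 0 : 'cV[K]_n.+1) i 0).
  rewrite (bigD1 i) //= big1 ?addr0; last first.
    by move=> j ji; rewrite !mxE eq_sym (negPf ji) mulr0.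
  by rewrite !mxE !eqxx mulr1.
rewrite -summxE; congr (fun_of_matrix _ i 0).
by apply: eq_bigr => j _; rewrite mxmod_kscale.
Qed.

(** A map from a matrix module to [N] amounts to vectors of [N] on which the
    generators act through the columns of the given matrices. *)
Section Intertwiner.

Variables (N : lmodType A) (w : 'I_n.+1 -> N).
Hypothesis wP : forall g j, pvar K rels g *: w j = \sum_i f g i j *k w i.

Definition mxmod_hom (v : mxmod fP) : N := \sum_i (v : 'cV[K]_n.+1) i 0 *k w i.

Lemma mxmod_hom_linear : linear mxmod_hom.
Proof.
have homD v v' : mxmod_hom (v + v') = mxmod_hom v + mxmod_hom v'.
  rewrite /mxmod_hom -big_split; apply: eq_bigr => i _.
  by rewrite mxE !scalerDl.
move=> u v v'; rewrite homD; congr (_ + _).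
elim/pcls_ind: u v => t; elim: t => [g|c|s IHs t IHt|s IHs t IHt] v.
- rewrite -/(pvar K rels g) mxmod_pvar /mxmod_hom scaler_sumr.
  under [RHS]eq_bigr do rewrite kscaleC wP scaler_sumr.
  rewrite exchange_big; apply: eq_bigr => i _ /=.
  under [RHS]eq_bigr do rewrite kscaleA.
  by rewrite -!scaler_suml !mxE; under eq_bigr do rewrite mulrC.
- have -> : pcls rels (PCst gen c) = c%:A :> A.
    by rewrite -[c%:A]/(pscale c _) pscaleE [RHS]mulr1.
  rewrite mxmod_kscale /mxmod_hom scaler_sumr.
  by apply: eq_bigr => i _; rewrite mxE kscaleA.
- have -> : pcls rels (PAdd s t) = pcls rels s + pcls rels t.
    by rewrite -[RHS]/(padd _ _) pcls_add.
  by rewrite !scalerDl homD IHs IHt.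
- have -> : pcls rels (PMul s t) = pcls rels s * pcls rels t.
    by rewrite -[RHS]/(pmul _ _) pcls_mul.
  by rewrite -!scalerA IHs IHt.
Qed.

Lemma iso_mxmod :
  simple_module N -> simple_module (mxmod fP) -> (exists j, w j != 0) ->
  module_iso N (mxmod fP).
Proof.
move=> simN simM [j wj0].
pose h : {linear mxmod fP -> N} :=
  HB.pack mxmod_hom (GRing.isLinear.Build _ _ _ _ _ mxmod_hom_linear).
apply: (@schur _ _ _ _ h (delta_mx j 0 : 'cV[K]_n.+1)) => //.
suff -> : h (delta_mx j 0 : 'cV[K]_n.+1) = w j by [].
rewrite /= /mxmod_hom (bigD1 j) //= big1 => [|i ij].
  by rewrite mxE !eqxx kscale1 addr0.
by rewrite mxE (negPf ij) kscale0.
Qed.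

End Intertwiner.
End MatrixModules.

(** * Simplicity of modules of dimension one and two *)

Section SimplicityCriteria.

Variables (K : fieldType) (gen : eqType) (rels : seq (seq gen * seq gen)).

Lemma mxmod1_simple (f : gen -> 'M[K]_1) (fP : satisfies rels f) :
  simple_module (mxmod fP).
Proof.
split=> [|S [S0 Slin]].
  by exists (1 : 'cV[K]_1); exact: oner_neq0.
have [[v /andP[Sv v0]]|noS] :=
    pselect (exists v : mxmod fP, (v \in S) && (v != 0)); last first.
  left=> v Sv; apply/eqP; apply: contra_notT noS => v0.
  by exists v; rewrite Sv.
right=> u; have v00 : (v : 'cV_1) 0 0 != 0.
  by apply: contraNneq v0 => e; apply/eqP/colP => i; rewrite ord1 e mxE.
have -> : u = ((u : 'cV_1) 0 0 / (v : 'cV_1) 0 0) *k v + 0.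
  rewrite addr0 mxmod_kscale; apply/colP => i.
  by rewrite ord1 mxE divfK.
exact: Slin.
Qed.

Definition col2 (a b : K) : 'cV[K]_2 := \col_i (if i == 0 :> nat then a else b).

Lemma col2P (v : 'cV[K]_2) : exists a b, v = col2 a b.
Proof.
exists (v 0 0), (v 1 0); apply/colP => -[[|[|?]] ?] //; rewrite mxE /=;
  by congr (v _ _); apply: val_inj.
Qed.

Lemma mx2_mul_col2 (p q r s a b : K) :
  mx2 p q r s *m col2 a b = col2 (p * a + q * b) (r * a + s * b).
Proof.
apply/colP => i; rewrite !mxE !big_ord_recl big_ord0 !mxE /= addr0.
by case: i => [[|[|?]] ?].
Qed.

Lemma col2Z (c a b : K) : c *: col2 a b = col2 (c * a) (c * b).
Proof. by apply/colP => i; rewrite !mxE; case: ifP. Qed.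

Lemma col2D (a b a' b' : K) : col2 a b + col2 a' b' = col2 (a + a') (b + b').
Proof. by apply/colP => i; rewrite !mxE; case: ifP. Qed.

(** A submodule containing a nonzero vector (a, b) contains an eigenvector of
    [g]: apply g - q to it if a <> 0.  Then [h], which exchanges the two
    eigenlines, produces the other basis vector. *)
Lemma mxmod2_simple (f : gen -> 'M[K]_2) (fP : satisfies rels f)
    (g h : gen) (p q r s : K) :
  f g = mx2 p 0 0 q -> f h = mx2 0 r s 0 -> p != q -> r != 0 -> s != 0 ->
  simple_module (mxmod fP).
Proof.
move=> fg fh pq r0 s0; split=> [|S [S0 Slin]].
  exists (const_mx 1 : 'cV[K]_2); apply/eqP => /colP/(_ 0).
  by rewrite !mxE => /eqP; rewrite oner_eq0.
have [[v /andP[Sv v0]]|noS] :=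
    pselect (exists v : mxmod fP, (v \in S) && (v != 0)); last first.
  left=> v Sv; apply/eqP; apply: contra_notT noS => v0.
  by exists v; rewrite Sv.
have SZ u w : w \in S -> u *: w \in S.
  by move=> Sw; rewrite -[_ *: _]addr0; apply: Slin.
have SK (c a b : K) : c != 0 -> (col2 (c * a) (c * b) : mxmod fP) \in S ->
    (col2 a b : mxmod fP) \in S.
  move=> c0 /(SZ c^-1%:A); rewrite mxmod_kscale col2Z !mulrA mulVf //.
  by rewrite !mul1r.
have Sg a b c : (col2 a b : mxmod fP) \in S ->
    (col2 ((p - c) * a) ((q - c) * b) : mxmod fP) \in S.
  move=> /(SZ (pvar K rels g + (- c)%:A)).
  rewrite scalerDl mxmod_pvar mxmod_kscale fg mx2_mul_col2 col2Z col2D.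
  by congr ((col2 _ _ : mxmod fP) \in S); ring.
have Sh a b : (col2 a b : mxmod fP) \in S ->
    (col2 (r * b) (s * a) : mxmod fP) \in S.
  move=> /(SZ (pvar K rels h)); rewrite mxmod_pvar fh mx2_mul_col2.
  by congr ((col2 _ _ : mxmod fP) \in S); ring.
suff [S0' S1'] : ((col2 1 0 : mxmod fP) \in S) /\ ((col2 0 1 : mxmod fP) \in S).
  right=> u; have [a [b ->]] := col2P u.
  have := Slin (a%:A) _ _ S0' (SZ (b%:A) _ S1').
  by rewrite !mxmod_kscale !col2Z col2D !mulr0 !mulr1 addr0 add0r.
have S10 : (col2 1 0 : mxmod fP) \in S -> (col2 0 1 : mxmod fP) \in S.
  by move=> /Sh; rewrite mulr0 => Se; apply: (SK s) => //; rewrite mulr0.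
have S01 : (col2 0 1 : mxmod fP) \in S -> (col2 1 0 : mxmod fP) \in S.
  by move=> /Sh; rewrite mulr0 => Se; apply: (SK r) => //; rewrite mulr0.
have [a [b vE]] := col2P v; rewrite {}vE {v} in v0 Sv.
have [a0|a0] := eqVneq a 0.
  have b0 : b != 0.
    by apply: contraNneq v0 => b0; rewrite a0 b0; apply/eqP/colP => i;
       rewrite !mxE if_same.
  have Se : (col2 0 1 : mxmod fP) \in S.
    by rewrite a0 in Sv; apply: (SK b) => //; rewrite mulr1 mulr0.
  by split=> //; apply: S01.
have Se : (col2 1 0 : mxmod fP) \in S.
  apply: (SK ((p - q) * a)); first by rewrite mulf_neq0 ?subr_eq0.
  by have := Sg _ _ q Sv; rewrite subrr mul0r mulr0 mulr1.
by split=> //; apply: S10.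
Qed.

End SimplicityCriteria.

(** * The modules of the list are simple and pairwise non-isomorphic *)

Section Family.

Variables (K : fieldType) (xi : K) (xiP : 4.-primitive_root xi).

Lemma N1_neq1 : -1 != 1 :> K.
Proof.
by rewrite -(xi_sqr xiP) -expr2 -(prim_order_dvd xiP).
Qed.

Lemma xi_neq0 : xi != 0.
Proof.
apply: contraTneq (oner_neq0 K) => xi0.
by rewrite -(prim_expr_order xiP) xi0 expr0n eqxx.
Qed.

Lemma sign_inj (i j : 'Z_2) : (-1) ^+ i = (-1) ^+ j :> K -> i = j.
Proof.
by case: i j => [[|[|?]] ?] [[|[|?]] ?] //= /eqP;
  try (move=> _; exact: val_inj);
  rewrite ?expr0 ?expr1 1?[1 == _]eq_sym (negPf N1_neq1).
Qed.

Lemma xi_exp_inj (i j : 'Z_4) : xi ^+ i = xi ^+ j -> i = j.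
Proof.
move/eqP; rewrite (eq_prim_root_expr xiP) => /eqP; rewrite !modn_small //.
exact: val_inj.
Qed.

(** The index sets are given by equations in 'Z_2, the matrices by signs; this
    translates the former into the latter. *)
Lemma Zp2_cases (m n : 'Z_2) :
  (m + n = 0 /\ n = m) \/ (m + n = 1 /\ (-1) ^+ n = - (-1) ^+ m :> K).
Proof.
by case: m n => [[|[|?]] ?] [[|[|?]] ?] //; [left|right|right|left];
  split; rewrite ?expr0 ?expr1 ?opprK //; apply: val_inj.
Qed.

Ltac mx2_word :=
  apply: mxmod_acts_as; rewrite !big_cons big_nil /= mulr1 ?scalar_mx2 ?mx2M;
  rewrite ?(mulr0, mul0r, addr0, add0r) ?(xi_inv xiP); congr mx2.

(** The scalars by which x^2, bc and ya act on the modules of the list. *)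
Definition x2_scalar (w : simple_index) : K :=
  if w is (inl _ | inr (inl (inl _))) then 1 else -1.

Definition bc_scalar (w : simple_index) : K :=
  match w with
  | inr (inl (inl w)) => let: (i, j, k, l, m, n) := val w in (-1) ^+ (m + n)%N
  | inr (inr _) => -1
  | _ => 1
  end.

Definition ya_scalar (w : simple_index) : K :=
  match w with
  | inl _ => 1
  | inr (inl (inl w)) => let: (i, j, k, l, m, n) := val w in (-1) ^+ (j + l)%N
  | inr (inl (inr w)) => let: (i, j, k, l) := val w in (-1) ^+ (j + k)%N
  | inr (inr w) => let: (i, j, k, l) := val w in (-1) ^+ (j + k)%N
  end.

Lemma sign_sqr (p : nat) : (-1) ^+ p * (-1) ^+ p = 1 :> K.
Proof. by rewrite -expr2 sqrr_sign. Qed.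

Lemma scalar_mx1M (p q : K) : p%:M * q%:M = (p * q)%:M :> 'M_1.
Proof. by rewrite -[LHS]/(_ *m _) -scalar_mxM. Qed.

Ltac chi_word :=
  apply: mxmod_acts_as; rewrite !big_cons big_nil mulr1 ?scalar_mx1M.

Ltac case_index w :=
  case: w => [[[[? ?] ?] ?]|[[[[[[[[? ?] ?] ?] ?] ?] ?]|[[[[? ?] ?] ?] ?]]
    |[[[[? ?] ?] ?] ?]]] /=.

Lemma x2_scalarP w :
  acts_as (wprod K Drels [:: Dx; Dx]) (x2_scalar w) (simple_family xiP w).
Proof.
case_index w.
- by chi_word; rewrite sign_sqr.
- by mx2_word; rewrite sign_sqr.
- by mx2_word; rewrite ?mulNr ?mulrN ?opprK (xi_sqr xiP).
- by mx2_word; rewrite ?mulNr ?mulrN ?opprK (xi_sqr xiP).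
Qed.

Lemma bc_scalarP w :
  acts_as (wprod K Drels [:: Db; Dc]) (bc_scalar w) (simple_family xiP w).
Proof.
case_index w.
- by chi_word; rewrite sign_sqr.
- by mx2_word; rewrite exprD // mulrC.
- by mx2_word; rewrite ?exprS ?mulN1r ?mulrNN sign_sqr.
- by mx2_word; rewrite ?exprS ?mulN1r ?mulrN ?mulNr sign_sqr.
Qed.

Lemma ya_scalarP w :
  acts_as (wprod K Drels [:: Dy; Da]) (ya_scalar w) (simple_family xiP w).
Proof.
case_index w.
- by chi_word; rewrite sign_sqr.
- by mx2_word; rewrite exprD.
- by mx2_word; rewrite exprD.
- by mx2_word; rewrite exprD.
Qed.

Section Scalars.
Implicit Types (i j k l m n : 'Z_2) (r : 'Z_4).

Lemma chi_x i r k l :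
  acts_as (wprod K Drels [:: Dx]) ((-1) ^+ i) (chi_module xiP i r k l).
Proof. by chi_word. Qed.
Lemma chi_t i r k l :
  acts_as (wprod K Drels [:: Dt]) ((-1) ^+ k) (chi_module xiP i r k l).
Proof. by chi_word. Qed.
Lemma chi_b i r k l :
  acts_as (wprod K Drels [:: Db]) ((-1) ^+ l) (chi_module xiP i r k l).
Proof. by chi_word. Qed.
Lemma chi_d i r k l :
  acts_as (wprod K Drels [:: Dd]) (xi ^+ r) (chi_module xiP i r k l).
Proof. by chi_word. Qed.

Lemma V_y i j k l m n :
  acts_as (wprod K Drels [:: Dy]) ((-1) ^+ j) (V_module K i j k l m n).
Proof. by mx2_word. Qed.
Lemma V_a i j k l m n :
  acts_as (wprod K Drels [:: Da]) ((-1) ^+ l) (V_module K i j k l m n).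
Proof. by mx2_word. Qed.

Lemma V1_bx j k l m n : (-1) ^+ n = - (-1) ^+ m :> K ->
  acts_as (wprod K Drels [:: Db; Dx]) ((-1) ^+ m) (V_module K 0 j k l m n).
Proof.
move=> nm; mx2_word; rewrite ?expr0 ?mulr1 //.
by rewrite add0n exprD nm mulNr mulrN mulrN opprK mulrA sign_sqr mul1r.
Qed.

Lemma V1_t i j k l m n : (-1) ^+ (j + l)%N = 1 :> K ->
  acts_as (wprod K Drels [:: Dt]) ((-1) ^+ k) (V_module K i j k l m n).
Proof. by move=> jl; mx2_word; rewrite // exprD jl mul1r. Qed.

(** When j + l = 1 the entries of t are opposite, and so are those of x, so
    that their product is a scalar matrix. *)
Lemma V1_tx j k l m n :
  (-1) ^+ (j + l)%N = -1 :> K -> (-1) ^+ n = - (-1) ^+ m :> K ->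
  acts_as (wprod K Drels [:: Dt; Dx]) ((-1) ^+ k) (V_module K 0 j k l m n).
Proof.
move=> jl nm; mx2_word; rewrite ?expr0 ?mulr1 //.
by rewrite add0n exprD jl exprD nm mulrN sign_sqr mulN1r mulrN mulr1 opprK.
Qed.

Lemma V2_x i j k l m :
  acts_as (wprod K Drels [:: Dx]) ((-1) ^+ i) (V_module K i j k l m m).
Proof.
by mx2_word; rewrite // -addnA exprD [X in _ * X]exprD sign_sqr mulr1.
Qed.

Lemma V2_b i j k l m :
  acts_as (wprod K Drels [:: Db]) ((-1) ^+ m) (V_module K i j k l m m).
Proof. by mx2_word. Qed.

Lemma W_y i j r l :
  acts_as (wprod K Drels [:: Dy]) ((-1) ^+ j) (W_module xiP i j r l).
Proof. by mx2_word. Qed.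

Lemma W_bx i j r l :
  acts_as (wprod K Drels [:: Db; Dx]) ((-1) ^+ l * xi) (W_module xiP i j r l).
Proof. by mx2_word; rewrite ?exprS // mulrN !mulNr mul1r opprK. Qed.

Lemma W_d i j r l : (-1) ^+ (j + r)%N = 1 :> K ->
  acts_as (wprod K Drels [:: Dd]) (xi ^+ r) (W_module xiP i j r l).
Proof. by move=> jr; mx2_word; rewrite // jr mul1r. Qed.

Lemma W_dx i j r l : (-1) ^+ (j + r)%N = -1 :> K ->
  acts_as (wprod K Drels [:: Dd; Dx]) (xi ^+ r * xi) (W_module xiP i j r l).
Proof. by move=> jr; mx2_word; rewrite // jr mulN1r mulrNN. Qed.

Lemma U_a i r k l :
  acts_as (wprod K Drels [:: Da]) ((-1) ^+ k) (U_module xiP i r k l).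
Proof. by mx2_word. Qed.

Lemma U_bx i r k l :
  acts_as (wprod K Drels [:: Db; Dx]) ((-1) ^+ l * xi) (U_module xiP i r k l).
Proof. by mx2_word; rewrite ?exprS // mulrN !mulNr mul1r opprK. Qed.

Lemma U_dt i r k l : (-1) ^+ (r + k)%N = 1 :> K ->
  acts_as (wprod K Drels [:: Dd; Dt]) (xi ^+ r) (U_module xiP i r k l).
Proof. by move=> jr; mx2_word; rewrite ?mulr1 // jr mul1r. Qed.

Lemma U_dtx i r k l : (-1) ^+ (r + k)%N = -1 :> K ->
  acts_as (wprod K Drels [:: Dd; Dt; Dx]) (xi ^+ r * xi) (U_module xiP i r k l).
Proof.
by move=> jr; mx2_word; rewrite ?(mulr0, mul0r, addr0, add0r, mul1r) // jr
  mulN1r mulrNN.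
Qed.
End Scalars.

Lemma sign_neqN (p : nat) : (-1) ^+ p != - (-1) ^+ p :> K.
Proof.
rewrite -signr_odd; case: (odd p); rewrite ?expr1 ?opprK ?N1_neq1 //.
by rewrite eq_sym N1_neq1.
Qed.

(** The two parts of the index set in terms of the matrix entries: b has
    distinct eigenvalues on the first one, and on the second one t does. *)
Lemma Omega_cases i j k l m n : (i, j, k, l, m, n) \in Omega ->
  (i = 0 /\ (-1) ^+ n = - (-1) ^+ m :> K) \/
  [/\ k = 0, n = m & (-1) ^+ l = - (-1) ^+ j :> K].
Proof.
rewrite !inE => /orP[/andP[/eqP-> /eqP mn]|/and3P[/eqP-> /eqP mn /eqP jl]].
  by left; split=> //; case: (Zp2_cases m n) => [[]|[_ ->//]]; rewrite mn.
right; split=> //.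
  by case: (Zp2_cases m n) => [[_ ->//]|[]]; rewrite mn.
by case: (Zp2_cases j l) => [[]|[_ ->//]]; rewrite jl.
Qed.

Lemma chi_simple i r k l : simple_module (chi_module xiP i r k l).
Proof. exact: mxmod1_simple. Qed.

Lemma V_simple i j k l m n :
  (i, j, k, l, m, n) \in Omega -> simple_module (V_module K i j k l m n).
Proof.
case/Omega_cases=> [[_ nm]|[k0 _ lj]].
  apply: (@mxmod2_simple _ _ _ _ (V_satisfies K i j k l m n) Db Dd) => //.
  - by rewrite nm sign_neqN.
  - exact: oner_neq0.
  - by rewrite signr_eq0.
apply: (@mxmod2_simple _ _ _ _ (V_satisfies K i j k l m n) Dt Dd) => //.
- by rewrite k0 addn0 exprD lj mulrN sign_sqr eq_sym N1_neq1.
- exact: oner_neq0.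
- by rewrite signr_eq0.
Qed.

Lemma xi_neqV : xi != xi^-1.
Proof.
apply: contraNneq N1_neq1 => xixi.
by rewrite -(xi_sqr xiP) {2}xixi mulfV ?xi_neq0.
Qed.

Lemma W_simple i j r l : simple_module (W_module xiP i j r l).
Proof.
exact: (@mxmod2_simple _ _ _ _ (W_satisfies xiP i j r l) Dx Dt)
  xi_neqV (oner_neq0 _) (oner_neq0 _).
Qed.

Lemma U_simple i r k l : simple_module (U_module xiP i r k l).
Proof.
exact: (@mxmod2_simple _ _ _ _ (U_satisfies xiP i r k l) Dx Dt)
  xi_neqV (oner_neq0 _) (oner_neq0 _).
Qed.

Lemma simple_family_simple w : simple_module (simple_family xiP w).
Proof.
case_index w.
- exact: chi_simple.
- exact: V_simple.
- exact: W_simple.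
- exact: U_simple.
Qed.

Lemma one_neqN1 : (1 : K) <> -1.
Proof. by move/eqP; rewrite eq_sym (negPf N1_neq1). Qed.

(** With bc = 1 the index lies in the second part of Omega, where ya = -1, while
    bc = ya = 1 on the one-dimensional modules. *)
Lemma V_not_chi i j k l m n : (i, j, k, l, m, n) \in Omega ->
  (-1) ^+ (m + n)%N = 1 :> K -> (-1) ^+ (j + l)%N = 1 :> K -> False.
Proof.
rewrite !exprD.
by case/Omega_cases=> [[_ ->]|[_ _ ->]] e1 e2; apply: one_neqN1;
  [rewrite -[LHS]e1 | rewrite -[LHS]e2]; rewrite mulrN sign_sqr.
Qed.

Lemma chi_inj i r k l i' r' k' l' :
  module_iso (chi_module xiP i r k l) (chi_module xiP i' r' k' l') ->
  (i, r, k, l) = (i', r', k', l').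
Proof.
move=> iso.
have sep := acts_as_iso (@chi_simple i r k l) iso.
have -> := sign_inj (sep _ _ _ (@chi_x i r k l) (@chi_x i' r' k' l')).
have -> := xi_exp_inj (sep _ _ _ (@chi_d i r k l) (@chi_d i' r' k' l')).
have -> := sign_inj (sep _ _ _ (@chi_t i r k l) (@chi_t i' r' k' l')).
by have -> := sign_inj (sep _ _ _ (@chi_b i r k l) (@chi_b i' r' k' l')).
Qed.

Lemma V_inj i j k l m n i' j' k' l' m' n' :
  (i, j, k, l, m, n) \in Omega -> (i', j', k', l', m', n') \in Omega ->
  (-1) ^+ (m + n)%N = (-1) ^+ (m' + n')%N :> K ->
  module_iso (V_module K i j k l m n) (V_module K i' j' k' l' m' n') ->
  (i, j, k, l, m, n) = (i', j', k', l', m', n').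
Proof.
move=> O O' mn iso.
have sep := acts_as_iso (V_simple O) iso.
have ej := sign_inj (sep _ _ _ (@V_y i j k l m n) (@V_y i' j' k' l' m' n')).
have el := sign_inj (sep _ _ _ (@V_a i j k l m n) (@V_a i' j' k' l' m' n')).
move: mn; rewrite !exprD; case: (Omega_cases O) (Omega_cases O')
   => [[i0 nm]|[k0 nm lj]] [[i0' nm']|[k0' nm' lj']].
- move=> _; subst i i' j' l'.
  have em := sign_inj (sep _ _ _ (V1_bx nm) (V1_bx nm')); subst m'.
  have -> : n' = n by apply: sign_inj; rewrite nm nm'.
  suff /sign_inj -> : (-1) ^+ k = (-1) ^+ k' :> K by [].
  have [jl|jl] := sign_cases K (j + l); first by apply: sep; apply: V1_t.
  by apply: sep; apply: V1_tx.
- by rewrite nm nm' mulrN !sign_sqr => /esym/one_neqN1.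
- by rewrite nm nm' mulrN !sign_sqr => /one_neqN1.
- move=> _; subst.
  have -> := sign_inj (sep _ _ _ (@V2_x _ _ _ _ _) (@V2_x _ _ _ _ _)).
  by have -> := sign_inj (sep _ _ _ (@V2_b _ _ _ _ _) (@V2_b _ _ _ _ _)).
Qed.

Lemma W_inj i j r l i' j' r' l' :
  (i, j, r, l) \in Lambda1 -> (i', j', r', l') \in Lambda1 ->
  (-1) ^+ (j + r)%N = (-1) ^+ (j' + r')%N :> K ->
  module_iso (W_module xiP i j r l) (W_module xiP i' j' r' l') ->
  (i, j, r, l) = (i', j', r', l').
Proof.
move=> L L' jr iso.
have sep := acts_as_iso (@W_simple i j r l) iso.
move: L L'; rewrite !inE => /eqP-> /eqP->.
have -> := sign_inj (sep _ _ _ (@W_y i j r l) (@W_y i' j' r' l')).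
have /(mulIf xi_neq0)/sign_inj -> := sep _ _ _ (@W_bx i j r l) (@W_bx i' j' r' l').
suff /xi_exp_inj -> : xi ^+ r = xi ^+ r' by [].
have [e|e] := sign_cases K (j + r).
  by apply: sep; apply: W_d; rewrite // -jr.
by apply: (mulIf xi_neq0); apply: sep; apply: W_dx; rewrite // -jr.
Qed.

Lemma U_inj i r k l i' r' k' l' :
  (i, r, k, l) \in Lambda2 -> (i', r', k', l') \in Lambda2 ->
  (-1) ^+ (r + k)%N = (-1) ^+ (r' + k')%N :> K ->
  module_iso (U_module xiP i r k l) (U_module xiP i' r' k' l') ->
  (i, r, k, l) = (i', r', k', l').
Proof.
move=> L L' rk iso.
have sep := acts_as_iso (@U_simple i r k l) iso.
move: L L'; rewrite !inE => /eqP-> /eqP->.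
have -> := sign_inj (sep _ _ _ (@U_a i r k l) (@U_a i' r' k' l')).
have /(mulIf xi_neq0)/sign_inj -> := sep _ _ _ (@U_bx i r k l) (@U_bx i' r' k' l').
suff /xi_exp_inj -> : xi ^+ r = xi ^+ r' by [].
have [e|e] := sign_cases K (r + k).
  by apply: sep; apply: U_dt; rewrite // -rk.
by apply: (mulIf xi_neq0); apply: sep; apply: U_dtx; rewrite // -rk.
Qed.

Lemma simple_family_inj w w' :
  module_iso (simple_family xiP w) (simple_family xiP w') -> w = w'.
Proof.
move=> iso; have sep := acts_as_iso (simple_family_simple w) iso.
have ez := sep _ _ _ (@x2_scalarP w) (@x2_scalarP w').
have ee := sep _ _ _ (@bc_scalarP w) (@bc_scalarP w').
have eq := sep _ _ _ (@ya_scalarP w) (@ya_scalarP w').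
have N1 : -1 <> (1 : K) by move/esym/one_neqN1.
case: w w' iso ez ee eq {sep}
  => [[[[i j] k] l]|[[[[[[[[i j] k] l] m] n] O]|[[[[i j] k] l] L]]
     |[[[[i j] k] l] L]]]
     [[[[i' j'] k'] l']|[[[[[[[[i' j'] k'] l'] m'] n'] O']|[[[[i' j'] k'] l'] L']]
     |[[[[i' j'] k'] l'] L']]] /= iso ez ee eq;
 try (by case: (one_neqN1 ez)); try (by case: (N1 ez));
 try (by case: (one_neqN1 ee)); try (by case: (N1 ee)).
- by rewrite (chi_inj iso).
- by case: (V_not_chi O').
- by case: (V_not_chi O).
- by congr (inr (inl (inl _))); apply: val_inj; apply: V_inj.
- by congr (inr (inl (inr _))); apply: val_inj; apply: W_inj.
- by congr (inr (inr _)); apply: val_inj; apply: U_inj.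
Qed.

End Family.

(** * Weight vectors *)

Section Weights.

Variables (K : fieldType) (xi : K) (xiP : 4.-primitive_root xi).
Variable N : lmodType (Dalg K).
Implicit Types (v : N) (al be ga la et s : K).

Local Notation "g |> v" := (pvar K Drels g *: v)
  (at level 38, right associativity).

(** Unlike [kscaleC], this does not apply to a scalar in the place of [g], so it
    can be iterated by rewriting. *)
Lemma gactC g (c : K) v : g |> (c *k v) = c *k (g |> v).
Proof. exact: kscaleC. Qed.

Lemma rel_aa v : Da |> Da |> v = v.
Proof. exact: (wact_nth_rel v (isT : 6 < size Drels)%N). Qed.
Lemma rel_yy v : Dy |> Dy |> v = v.
Proof. exact: (wact_nth_rel v (isT : 1 < size Drels)%N). Qed.
Lemma rel_bb v : Db |> Db |> v = v.
Proof. exact: (wact_nth_rel v (isT : 7 < size Drels)%N). Qed.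
Lemma rel_cc v : Dc |> Dc |> v = v.
Proof. exact: (wact_nth_rel v (isT : 8 < size Drels)%N). Qed.
Lemma rel_tt v : Dt |> Dt |> v = v.
Proof. exact: (wact_nth_rel v (isT : 2 < size Drels)%N). Qed.
Lemma rel_xxxx v : Dx |> Dx |> Dx |> Dx |> v = v.
Proof. exact: (wact_nth_rel v (isT : 0 < size Drels)%N). Qed.
Lemma rel_xa v : Dx |> Da |> v = Da |> Dx |> v.
Proof. exact: (wact_nth_rel v (isT : 16 < size Drels)%N). Qed.
Lemma rel_xy v : Dx |> Dy |> v = Dy |> Dx |> v.
Proof. exact: (wact_nth_rel v (isT : 3 < size Drels)%N). Qed.
Lemma rel_xb v : Dx |> Db |> v = Db |> Dx |> v.
Proof. exact: (wact_nth_rel v (isT : 17 < size Drels)%N). Qed.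
Lemma rel_xc v : Dx |> Dc |> v = Dc |> Dx |> v.
Proof. exact: (wact_nth_rel v (isT : 18 < size Drels)%N). Qed.
Lemma rel_ya v : Dy |> Da |> v = Da |> Dy |> v.
Proof. exact: (wact_nth_rel v (isT : 20 < size Drels)%N). Qed.
Lemma rel_yb v : Dy |> Db |> v = Db |> Dy |> v.
Proof. exact: (wact_nth_rel v (isT : 21 < size Drels)%N). Qed.
Lemma rel_yc v : Dy |> Dc |> v = Dc |> Dy |> v.
Proof. exact: (wact_nth_rel v (isT : 22 < size Drels)%N). Qed.
Lemma rel_ab v : Da |> Db |> v = Db |> Da |> v.
Proof. exact: (wact_nth_rel v (isT : 9 < size Drels)%N). Qed.
Lemma rel_ac v : Da |> Dc |> v = Dc |> Da |> v.
Proof. exact: (wact_nth_rel v (isT : 10 < size Drels)%N). Qed.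
Lemma rel_bc v : Db |> Dc |> v = Dc |> Db |> v.
Proof. exact: (wact_nth_rel v (isT : 11 < size Drels)%N). Qed.
Lemma rel_dd v : Dd |> Dd |> v = Da |> v.
Proof. exact: (wact_nth_rel v (isT : 12 < size Drels)%N). Qed.
Lemma rel_da v : Dd |> Da |> v = Da |> Dd |> v.
Proof. exact: (wact_nth_rel v (isT : 13 < size Drels)%N). Qed.
Lemma rel_db v : Dd |> Db |> v = Dc |> Dd |> v.
Proof. exact: (wact_nth_rel v (isT : 14 < size Drels)%N). Qed.
Lemma rel_dc v : Dd |> Dc |> v = Db |> Dd |> v.
Proof. exact: (wact_nth_rel v (isT : 15 < size Drels)%N). Qed.
Lemma rel_xd v : Dx |> Dd |> v = Db |> Dc |> Dd |> Dx |> v.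
Proof. exact: (wact_nth_rel v (isT : 19 < size Drels)%N). Qed.
Lemma rel_yd v : Dy |> Dd |> v = Dd |> Dy |> v.
Proof. exact: (wact_nth_rel v (isT : 23 < size Drels)%N). Qed.
Lemma rel_tx v : Dt |> Dx |> v = Dx |> Dx |> Dx |> Dt |> v.
Proof. exact: (wact_nth_rel v (isT : 4 < size Drels)%N). Qed.
Lemma rel_ty v : Dt |> Dy |> v = Dy |> Dt |> v.
Proof. exact: (wact_nth_rel v (isT : 5 < size Drels)%N). Qed.
Lemma rel_ta v : Dt |> Da |> v = Da |> Dt |> v.
Proof. exact: (wact_nth_rel v (isT : 24 < size Drels)%N). Qed.
Lemma rel_tb v : Dt |> Db |> v = Db |> Dx |> Dx |> Dt |> v.
Proof. exact: (wact_nth_rel v (isT : 25 < size Drels)%N). Qed.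
Lemma rel_tc v : Dt |> Dc |> v = Dc |> Dx |> Dx |> Dt |> v.
Proof. exact: (wact_nth_rel v (isT : 26 < size Drels)%N). Qed.
Lemma rel_td v : Dt |> Dd |> v = Da |> Dd |> Dy |> Dt |> v.
Proof. exact: (wact_nth_rel v (isT : 27 < size Drels)%N). Qed.

(** The generator d is invertible, since d^2 = a and a^2 = 1. *)
Lemma Dd_neq0 v : v != 0 -> Dd |> v != 0.
Proof.
by apply: contraNneq => dv0; rewrite -(rel_aa v) -(rel_dd v) dv0 !scaler0.
Qed.

Lemma Dt_neq0 v : v != 0 -> Dt |> v != 0.
Proof. by apply: contraNneq => tv0; rewrite -(rel_tt v) tv0 scaler0. Qed.

(** The joint eigenspaces, for the eigenvalues of a, y, b, c, x in this order. *)
Definition weight al et be ga la v : Prop :=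
  [/\ Da |> v = al *k v, Dy |> v = et *k v, Db |> v = be *k v,
      Dc |> v = ga *k v & Dx |> v = la *k v].

Lemma weight_ksubspace al et be ga la : ksubspace (weight al et be ga la).
Proof.
by move=> c u v [? ? ? ? ?] [? ? ? ? ?]; split; apply: eigen_ksubspace.
Qed.

Lemma weight_d al et be ga la v :
  weight al et be ga la v -> weight al et ga be (be * ga * la) (Dd |> v).
Proof.
case=> va vy vb vc vx; split.
- by rewrite -rel_da va gactC.
- by rewrite rel_yd vy gactC.
- by rewrite -rel_dc vc gactC.
- by rewrite -rel_db vb gactC.
- rewrite rel_xd vx !gactC -rel_db vb !gactC -rel_dc vc gactC !kscaleA.
  by congr (_ *k _); ring.
Qed.

(** From t x = x^-1 t and t b = b x^2 t; as la is a fourth root of unity, la^3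
    is the inverse of la and la^2 that of la^2. *)
Lemma weight_t al et be ga la v : la ^+ 4 = 1 ->
  weight al et be ga la v ->
  weight al et (la ^+ 2 * be) (la ^+ 2 * ga) (la ^+ 3) (Dt |> v).
Proof.
move=> la4 [va vy vb vc vx].
have xt : Dx |> Dt |> v = la ^+ 3 *k (Dt |> v).
  have := rel_xxxx (Dt |> v); rewrite -rel_tx vx !gactC => xt.
  rewrite -{2}xt kscaleA -exprSr la4 kscale1 //.
have xxt : Dx |> Dx |> Dt |> v = la ^+ 2 *k (Dt |> v).
  rewrite xt gactC xt kscaleA -exprD (_ : 3 + 3 = 4 + 2)%N //.
  by rewrite exprD la4 mul1r.
split=> //.
- by rewrite -rel_ta va gactC.
- by rewrite -rel_ty vy gactC.
- have := rel_tb v; rewrite xxt vb !gactC => tb.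
  by rewrite -kscaleA tb kscaleA -exprD la4 kscale1.
- have := rel_tc v; rewrite xxt vc !gactC => tc.
  by rewrite -kscaleA tc kscaleA -exprD la4 kscale1.
Qed.

(** On a weight space the relation td = adyt reduces to a commutation up to the
    sign by which ya acts. *)
Lemma weight_td al et be ga la v : weight al et be ga la v ->
  Dt |> Dd |> v = (al * et) *k (Dd |> Dt |> v).
Proof.
case=> va vy _ _ _.
by rewrite rel_td -rel_da -rel_ty vy !gactC -rel_ta va !gactC kscaleA mulrC.
Qed.

Lemma sqr1_sign (d : K) : d ^+ 2 = 1 -> exists i : 'Z_2, d = (-1) ^+ i.
Proof.
by move/eqP; rewrite sqrf_eq1 => /orP[] /eqP->; [exists 0 | exists 1].
Qed.

(** A square root of (-1)^j is a power of xi, and the parity of its exponent is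
    that of j; this is how one index in 'Z_4 encodes the eigenvalue of d or dt
    together with its square. *)
Lemma sqr_sign_xi (d : K) (j : 'Z_2) : d ^+ 2 = (-1) ^+ j ->
  exists2 r : 'Z_4, d = xi ^+ r & (-1) ^+ r = (-1) ^+ j :> K.
Proof.
move=> d2.
have [|r dr] := prim_rootP xiP (x := d).
  by rewrite (exprM d 2 2) d2 sqrr_sign.
exists r => //.
by rewrite -(xi_pow_sqr xiP) -dr -expr2.
Qed.

Lemma xi_sqrX (j : nat) : (xi ^+ j) ^+ 2 = (-1) ^+ j.
Proof. by rewrite expr2 (xi_pow_sqr xiP). Qed.

(** The square root needed in [eigen_refine] is a power of xi. *)
Lemma eigen_sqr (P : N -> Prop) (u : Dalg K) (j : nat) v :
  ksubspace P -> v != 0 -> P v -> P (u *: v) ->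
  u *: (u *: v) = ((-1) ^+ j) *k v ->
  exists w, [/\ w != 0, P w & exists2 d, d ^+ 2 = (-1) ^+ j & u *: w = d *k w].
Proof. by rewrite -xi_sqrX; apply: eigen_refine. Qed.

(** The operators a, y, b, c are diagonalized one after the other on the joint
    eigenspace of the previous ones, then x^2, whose square is 1, and finally x,
    whose square acts by a sign once x^2 is diagonalized. *)
Lemma weight_exists : (exists v, v != 0) ->
  exists al et be ga la v, [/\ v != 0, weight al et be ga la v &
  [/\ al ^+ 2 = 1, et ^+ 2 = 1, be ^+ 2 = 1, ga ^+ 2 = 1 &
      la ^+ 2 = 1 \/ la ^+ 2 = -1]].
Proof.
move=> [v0 nz0].
pose E g c (u : N) := g |> u = c *k u.
have I (u : N) : u = ((-1) ^+ 0) *k u by rewrite expr0 kscale1.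
pose P0 (_ : N) := True.
have S0 : ksubspace P0 by [].
have [v1 [nz1 _ [al al2 va1]]] :=
  eigen_sqr S0 nz0 Logic.I Logic.I (etrans (rel_aa v0) (I _)).
pose P1 u := E Da al u.
have S1 : ksubspace P1 by move=> c u w; apply: eigen_ksubspace.
have y1 : P1 (Dy |> v1) by rewrite /P1 /E -rel_ya va1 gactC.
have [v2 [nz2 va2 [et et2 vy2]]] :=
  eigen_sqr S1 nz1 va1 y1 (etrans (rel_yy v1) (I _)).
pose P2 u := E Da al u /\ E Dy et u.
have S2 : ksubspace P2.
  by move=> c u w [? ?] [? ?]; split; apply: eigen_ksubspace.
have b2 : P2 (Db |> v2).
  by rewrite /P2 /E rel_ab rel_yb va2 vy2 !gactC.
have [v3 [nz3 [va3 vy3] [be be2 vb3]]] :=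
  eigen_sqr S2 nz2 (conj va2 vy2) b2 (etrans (rel_bb v2) (I _)).
pose P3 u := [/\ E Da al u, E Dy et u & E Db be u].
have S3 : ksubspace P3.
  by move=> c u w [? ? ?] [? ? ?]; split; apply: eigen_ksubspace.
have c3 : P3 (Dc |> v3).
  by rewrite /P3 /E rel_ac rel_yc rel_bc va3 vy3 vb3 !gactC.
have [v4 [nz4 [va4 vy4 vb4] [ga ga2 vc4]]] :=
  eigen_sqr S3 nz3 (And3 va3 vy3 vb3) c3 (etrans (rel_cc v3) (I _)).
pose P4 u := [/\ E Da al u, E Dy et u, E Db be u & E Dc ga u].
have S4 : ksubspace P4.
  by move=> c u w [? ? ? ?] [? ? ? ?]; split; apply: eigen_ksubspace.
have xP4 u : P4 u -> P4 (Dx |> u).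
  case=> ua uy ub uc; rewrite /P4 /E -rel_xa -rel_xy -rel_xb -rel_xc.
  by rewrite ua uy ub uc !gactC.
have [|||v5 [nz5 P5 [z z2 vz]]] :=
  @eigen_sqr _ (pvar K Drels Dx * pvar K Drels Dx) 0 _ S4 nz4.
- by split.
- by rewrite -scalerA; do 2![apply: (xP4)]; split.
- by rewrite -!scalerA rel_xxxx expr0 kscale1.
have [i zi] := sqr1_sign z2; rewrite -scalerA zi in vz.
have [v [nzv [va vy vb vc] [la la2 vx]]] := eigen_sqr S4 nz5 P5 (xP4 _ P5) vz.
exists al, et, be, ga, la, v; split=> //; split=> //.
by rewrite la2; apply: sign_cases.
Qed.

Lemma mx2_iso (f : Dgen -> 'M[K]_2) (fP : satisfies Drels f) v w :
  simple_module N -> simple_module (mxmod fP) -> v != 0 ->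
  (forall g, g |> v = f g 0 0 *k v + f g 1 0 *k w) ->
  (forall g, g |> w = f g 0 1 *k v + f g 1 1 *k w) ->
  module_iso N (mxmod fP).
Proof.
move=> simN simM v0 gv gw.
pose vw (i : 'I_2) := if i == 0 :> nat then v else w.
apply: (@iso_mxmod _ _ _ _ _ _ _ vw) => //; rewrite /vw.
  move=> g j; rewrite !big_ord_recl big_ord0 addr0 /=.
  have -> : lift ord0 ord0 = 1 :> 'I_2 by apply: val_inj.
  by case: j => [[|[|?]] ?] //=; rewrite ?gv ?gw;
    congr (f g _ _ *k _ + f g _ _ *k _); apply: val_inj.
by exists 0.
Qed.

End Weights.

(** * Locating a simple module in the list *)

Section Homs.

Variables (K : fieldType) (xi : K) (xiP : 4.-primitive_root xi).
Variable N : lmodType (Dalg K).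
Hypothesis simN : simple_module N.
Implicit Types (v : N) (al be ga la et s : K).
Implicit Types (i j k l m n : 'Z_2) (r : 'Z_4).

Local Notation "g |> v" := (pvar K Drels g *: v)
  (at level 38, right associativity).

Lemma chi_hom i r k l v : v != 0 ->
  weight ((-1) ^+ r) ((-1) ^+ r) ((-1) ^+ l) ((-1) ^+ l) ((-1) ^+ i) v ->
  Dt |> v = (-1) ^+ k *k v -> Dd |> v = xi ^+ r *k v ->
  module_iso N (chi_module xiP i r k l).
Proof.
move=> v0 [va vy vb vc vx] vt vd.
apply: (@iso_mxmod _ _ _ _ _ _ _ (fun _ => v)) => //; last by exists 0.
  by move=> g q; rewrite big_ord1 (ord1 q); case: g; rewrite /= mxE ?mulr1n.
exact: chi_simple.
Qed.

Ltac mx2_columns :=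
  case; rewrite /= ?scalar_mx2 !mxE /= ?kscale0 ?kscale1 ?addr0 ?add0r.

Lemma V_hom i j k l m n v : (i, j, k, l, m, n) \in Omega -> v != 0 ->
  weight ((-1) ^+ l) ((-1) ^+ j) ((-1) ^+ m) ((-1) ^+ n) ((-1) ^+ i) v ->
  Dt |> v = (-1) ^+ k *k v ->
  module_iso N (V_module K i j k l m n).
Proof.
move=> O v0 wv vt; have [va vy vb vc vx] := wv.
have [wa wy wb wc wx] := weight_d wv.
(* The sign in the second basis vector puts the entry 1 of d above the
   diagonal, as d (d v) = a v. *)
apply: (mx2_iso (v := v) (w := (-1) ^+ l *k (Dd |> v))) => //.
- exact: (V_simple xiP).
- by mx2_columns; rewrite ?kscaleA ?sign_sqr ?kscale1.
- mx2_columns.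
  + by rewrite gactC wa.
  + by rewrite gactC wb !kscaleA mulrC.
  + by rewrite gactC wc !kscaleA mulrC.
  + by rewrite gactC rel_dd va kscaleA sign_sqr kscale1.
  + by rewrite gactC wx !kscaleA !exprD; congr (_ *k _); ring.
  + by rewrite gactC wy !kscaleA mulrC.
  + rewrite gactC (weight_td wv) vt gactC !kscaleA !exprD.
    by congr (_ *k _); ring.
Qed.

Lemma W_hom j r l v : v != 0 ->
  weight ((-1) ^+ r) ((-1) ^+ j) ((-1) ^+ l) ((-1) ^+ l) xi v ->
  Dd |> v = xi ^+ r *k v ->
  module_iso N (W_module xiP 1 j r l).
Proof.
move=> v0 wv vd; have [va vy vb vc vx] := wv.
have [ta ty tb tc tx] := weight_t (prim_expr_order xiP) wv.
have xi2 : xi ^+ 2 = -1 by rewrite expr2 (xi_sqr xiP).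
have xi3 : xi ^+ 3 = xi^-1 by rewrite exprS xi2 mulrN1 (xi_inv xiP).
apply: (mx2_iso (v := v) (w := Dt |> v)) => //.
- exact: W_simple.
- by mx2_columns.
- mx2_columns; rewrite ?rel_tt //.
  + by rewrite tb xi2 exprS.
  + by rewrite tc xi2 exprS.
  (* Solving t d v = al et d t v for d (t v). *)
  + have := weight_td wv; rewrite vd gactC => td.
    have := congr1 (fun u => ((-1) ^+ r * (-1) ^+ j) *k u) td.
    rewrite /= !kscaleA (_ : _ * _ * (_ * _) = 1) ?kscale1 => [<-|].
      by congr (_ *k _); rewrite exprD; ring.
    by rewrite mulrACA !sign_sqr mulr1.
  + by rewrite tx xi3.
Qed.

Lemma U_hom r k l v : v != 0 ->
  weight ((-1) ^+ k) ((-1) ^+ r) ((-1) ^+ l) (- (-1) ^+ l) xi v ->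
  Dd |> Dt |> v = xi ^+ r *k v ->
  module_iso N (U_module xiP 1 r k l).
Proof.
move=> v0 wv vdt; have [va vy vb vc vx] := wv.
have [ta ty tb tc tx] := weight_t (prim_expr_order xiP) wv.
have xi2 : xi ^+ 2 = -1 by rewrite expr2 (xi_sqr xiP).
have xi3 : xi ^+ 3 = xi^-1 by rewrite exprS xi2 mulrN1 (xi_inv xiP).
apply: (mx2_iso (v := v) (w := Dt |> v)) => //.
- exact: U_simple.
- mx2_columns => //; rewrite ?exprS ?mulN1r //.
  rewrite -[LHS]rel_tt (weight_td wv) vdt kscaleA gactC.
  by congr (_ *k _); rewrite exprD; ring.
- mx2_columns; rewrite ?rel_tt //.
  + by rewrite tb xi2 exprS.
  + by rewrite tc xi2 mulrN mulN1r opprK.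
  + by rewrite tx xi3.
Qed.

Lemma sum_Zp2_1 m n : (-1) ^+ n = - (-1) ^+ m :> K -> m + n = 1.
Proof.
move=> nm; case: (Zp2_cases K m n) => [[_ e]|[]//].
by have := sign_neqN xiP m; rewrite -nm e eqxx.
Qed.

Lemma Omega_1 j k l m n : (-1) ^+ n = - (-1) ^+ m :> K ->
  (0, j, k, l, m, n) \in Omega.
Proof. by move=> /sum_Zp2_1 mn; rewrite !inE mn !eqxx. Qed.

Lemma Omega_2 i j l m : (-1) ^+ l = - (-1) ^+ j :> K ->
  (i, j, 0, l, m, m) \in Omega.
Proof.
move=> /sum_Zp2_1 jl; rewrite !inE jl !eqxx andbT /=; apply/orP; right.
by rewrite -mulr2n -mulr_natr (_ : 2%:R = 0) ?mulr0 //; apply: val_inj.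
Qed.

Local Notation listed := (exists w, module_iso N (simple_family xiP w)).

Lemma sign_Zp2D i j : (-1) ^+ (i + j)%R = (-1) ^+ (i + j)%N :> K.
Proof. by rewrite -[RHS]signr_odd; case: i j => [[|[|?]] ?] [[|[|?]] ?]. Qed.

Lemma V_listed i j k l m n : (i, j, k, l, m, n) \in Omega ->
  module_iso N (V_module K i j k l m n) -> listed.
Proof.
by move=> O iso; exists (inr (inl (inl (exist (fun w => w \in Omega) _ O)))).
Qed.

Lemma weight_d_eq al et be la v : be * be = 1 ->
  weight al et be be la v -> weight al et be be la (Dd |> v).
Proof. by move=> be2 /weight_d; rewrite be2 mul1r. Qed.

(** Here bc = -1, so x has opposite eigenvalues on v and d v, and one of the two
    vectors has x-eigenvalue 1, as the normalization i = 0 requires. *)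
Lemma listed_xsplit i j k l m n v : (-1) ^+ n = - (-1) ^+ m :> K -> v != 0 ->
  weight ((-1) ^+ l) ((-1) ^+ j) ((-1) ^+ m) ((-1) ^+ n) ((-1) ^+ i) v ->
  Dt |> v = (-1) ^+ k *k v -> listed.
Proof.
move=> nm v0 wv vt.
have [[_ i0]|[_ i1]] := Zp2_cases K i 0.
  rewrite -i0 in wv; apply: (V_listed (Omega_1 j k l nm)).
  by apply: V_hom wv vt => //; apply: Omega_1.
have mn : (-1) ^+ m = - (-1) ^+ n :> K by rewrite nm opprK.
have O := Omega_1 j (l + j + k) l mn.
apply: (V_listed O); apply: (V_hom O (Dd_neq0 v0)).
- suff -> : (-1) ^+ (0 : 'Z_2)%R = (-1) ^+ m * (-1) ^+ n * (-1) ^+ i :> K.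
    exact: weight_d.
  by rewrite i1 nm mulrN sign_sqr mulN1r.
- rewrite (weight_td wv) vt gactC kscaleA; congr (_ *k _).
  by rewrite !(sign_Zp2D, exprD).
Qed.

(** Here ya = -1, so t has opposite eigenvalues on v and d v, and one of the two
    vectors has t-eigenvalue 1, as the normalization k = 0 requires. *)
Lemma listed_tsplit i j k l m v : (-1) ^+ l = - (-1) ^+ j :> K -> v != 0 ->
  weight ((-1) ^+ l) ((-1) ^+ j) ((-1) ^+ m) ((-1) ^+ m) ((-1) ^+ i) v ->
  Dt |> v = (-1) ^+ k *k v -> listed.
Proof.
move=> lj v0 wv vt; have O := Omega_2 i m lj; apply: (V_listed O).
have [[_ k0]|[_ k1]] := Zp2_cases K k 0.
  by apply: (V_hom O v0 wv); rewrite k0.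
apply: (V_hom O (Dd_neq0 v0)).
  exact: weight_d_eq (sign_sqr K m) _.
rewrite (weight_td wv) vt gactC kscaleA; congr (_ *k _).
by rewrite k1 lj mulNr sign_sqr mulN1r.
Qed.

(** Here d commutes with all the generators on the weight space, so v can be
    taken to be an eigenvector of d. *)
Lemma listed_chi i j k m v : v != 0 ->
  weight ((-1) ^+ j) ((-1) ^+ j) ((-1) ^+ m) ((-1) ^+ m) ((-1) ^+ i) v ->
  Dt |> v = (-1) ^+ k *k v -> listed.
Proof.
move=> v0 wv vt.
pose P (u : N) :=
  weight ((-1) ^+ j) ((-1) ^+ j) ((-1) ^+ m) ((-1) ^+ m) ((-1) ^+ i) u /\
  Dt |> u = (-1) ^+ k *k u.
have Psub : ksubspace P.
  move=> c u w [wu tu] [ww tw]; split; first exact: weight_ksubspace.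
  exact: eigen_ksubspace.
have [||w [w0 [ww wt] [d]]] :=
  eigen_sqr xiP (j := j) (u := pvar K Drels Dd) Psub v0 (conj wv vt).
- split; last by rewrite (weight_td wv) vt sign_sqr kscale1 gactC.
  exact: weight_d_eq (sign_sqr K m) _.
- by rewrite rel_dd; case: wv.
case/(sqr_sign_xi xiP) => r -> er wd; rewrite -er in ww.
by exists (inl (i, r, k, m)); apply: chi_hom ww wt wd.
Qed.

(** With x^2 = 1 the operator t preserves the weight of v. *)
Lemma listed_x2_1 i j l m n v : v != 0 ->
  weight ((-1) ^+ l) ((-1) ^+ j) ((-1) ^+ m) ((-1) ^+ n) ((-1) ^+ i) v ->
  listed.
Proof.
move=> v0 wv.
have S := @weight_ksubspace K N ((-1) ^+ l) ((-1) ^+ j)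
  ((-1) ^+ m) ((-1) ^+ n) ((-1) ^+ i).
have [||w [w0 ww [ta]]] :=
  eigen_sqr xiP (j := 0) (u := pvar K Drels Dt) S v0 wv.
- have la4 : ((-1) ^+ i) ^+ 4 = 1 :> K.
    by rewrite (exprM _ 2 2) sqrr_sign expr1n.
  by have := weight_t la4 wv; rewrite (exprS _ 2) sqrr_sign !mul1r mulr1.
- by rewrite rel_tt expr0 kscale1.
case/sqr1_sign=> k -> wt.
have [[_ nm]|[_ nm]] := Zp2_cases K m n; last exact: listed_xsplit nm w0 ww wt.
rewrite nm in ww.
have [[_ lj]|[_ lj]] := Zp2_cases K j l; last exact: listed_tsplit lj w0 ww wt.
by rewrite lj in ww; apply: listed_chi w0 ww wt.
Qed.

(** The weight of v is preserved by d if bc = 1 and by dt if bc = -1. *)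
Lemma listed_xi j l m n v : v != 0 ->
  weight ((-1) ^+ l) ((-1) ^+ j) ((-1) ^+ m) ((-1) ^+ n) xi v -> listed.
Proof.
move=> v0 wv.
have S := @weight_ksubspace K N ((-1) ^+ l) ((-1) ^+ j)
  ((-1) ^+ m) ((-1) ^+ n) xi.
have [[_ nm]|[_ nm]] := Zp2_cases K m n.
  rewrite nm in wv S.
  have [||w [w0 ww [d]]] :=
    eigen_sqr xiP (j := l) (u := pvar K Drels Dd) S v0 wv.
  - exact: weight_d_eq (sign_sqr K m) _.
  - by rewrite rel_dd; case: wv.
  case/(sqr_sign_xi xiP) => r -> er wd; rewrite -er in ww.
  have L : (1, j, r, m) \in Lambda1 by rewrite inE.
  exists (inr (inl (inr (exist (fun w => w \in Lambda1) _ L)))).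
  by apply: W_hom ww wd.
have dtw u : weight ((-1) ^+ l) ((-1) ^+ j) ((-1) ^+ m) ((-1) ^+ n) xi u ->
    weight ((-1) ^+ l) ((-1) ^+ j) ((-1) ^+ m) ((-1) ^+ n) xi (Dd |> Dt |> u).
  move=> /(weight_t (prim_expr_order xiP))/weight_d.
  rewrite (exprS _ 2) expr2 (xi_sqr xiP) nm mulrN1 !mulN1r opprK.
  by rewrite mulNr sign_sqr mulN1r opprK.
have [||w [w0 ww [d]]] :=
    eigen_sqr xiP (j := j) (u := pvar K Drels Dd * pvar K Drels Dt) S v0 wv.
- by rewrite -scalerA; apply: dtw.
- rewrite -!scalerA (weight_td (weight_t (prim_expr_order xiP) wv)).
  rewrite rel_tt gactC rel_dd; have [-> _ _ _ _] := wv.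
  by rewrite kscaleA mulrAC sign_sqr mul1r.
case/(sqr_sign_xi xiP) => r -> er; rewrite -scalerA => wd.
rewrite nm -er in ww.
have L : (1, r, l, m) \in Lambda2 by rewrite inE.
by exists (inr (inr (exist (fun w => w \in Lambda2) _ L))); apply: U_hom ww wd.
Qed.

Lemma simple_family_complete : listed.
Proof.
have [nz _] := simN.
have [al [et [be [ga [la [v [v0 wv []]]]]]]] := weight_exists xiP nz.
move=> /sqr1_sign[l al_l] /sqr1_sign[j et_j] be2 ga2 la2.
have xi_case be' ga' (u : N) : be' ^+ 2 = 1 -> ga' ^+ 2 = 1 -> u != 0 ->
    weight al et be' ga' xi u -> listed.
  move=> /sqr1_sign[m ->] /sqr1_sign[n ->] u0; rewrite al_l et_j.
  exact: (listed_xi u0).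
case: la2 => [/sqr1_sign[i la_i]|la2].
  have [[m be_m] [n ga_n]] := (sqr1_sign be2, sqr1_sign ga2).
  by rewrite al_l et_j be_m ga_n la_i in wv; apply: listed_x2_1 wv.
have /orP[/eqP la_xi|/eqP la_xi] : (la == xi) || (la == - xi).
- by rewrite -eqf_sqr la2 expr2 (xi_sqr xiP).
- by rewrite la_xi in wv; apply: xi_case wv.
(* If x acts on v by - xi, it acts on t v by xi. *)
have la4 : la ^+ 4 = 1 by rewrite (exprM _ 2 2) la2 sqrrN expr1n.
have := weight_t la4 wv; rewrite (exprS _ 2) la2 !mulN1r mulrN1 la_xi opprK.
by apply: xi_case; rewrite ?sqrrN //; apply: Dt_neq0.
Qed.

End Homs.

(** * Counting the indices *)

Section Cards.

Lemma dim1_index_card : #|dim1_index| = 32%N.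
Proof. by rewrite !card_prod !card_ord. Qed.

Lemma card_Lambda1 : #|Lambda1| = 16%N.
Proof.
have -> : Lambda1 = setX (setX (setX [set 1] setT) setT) setT.
  by apply/setP => -[[[i j] k] l]; rewrite !inE !andbT.
by rewrite !cardsX cards1 !cardsT !card_ord.
Qed.

Lemma card_Lambda2 : #|Lambda2| = 16%N.
Proof.
have -> : Lambda2 = setX (setX (setX [set 1] setT) setT) setT.
  by apply/setP => -[[[i j] k] l]; rewrite !inE !andbT.
by rewrite !cardsX cards1 !cardsT !card_ord.
Qed.

Lemma card_Omega1 : #|Omega1| = 16%N.
Proof.
pose F (w : 'Z_2 * 'Z_2 * 'Z_2 * 'Z_2) :
    'Z_2 * 'Z_2 * 'Z_2 * 'Z_2 * 'Z_2 * 'Z_2 :=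
  let: (j, k, l, m) := w in (0, j, k, l, m, 1 - m).
have F_inj : injective F by move=> [[[? ?] ?] ?] [[[? ?] ?] ?] [-> -> -> ->].
have -> : Omega1 = F @: setT.
  apply/setP => -[[[[[i j] k] l] m] n]; rewrite inE.
  apply/andP/imsetP =>
    [[/eqP-> /eqP mn]|[[[[j' k'] l'] m'] _ [-> _ _ _ -> ->]]].
    by exists (j, k, l, m); rewrite ?inE //= -mn addrC addKr.
  by rewrite subrKC.
by rewrite card_imset // cardsT !card_prod !card_ord.
Qed.

Lemma card_Omega2 : #|Omega2| = 8%N.
Proof.
pose F (w : 'Z_2 * 'Z_2 * 'Z_2) : 'Z_2 * 'Z_2 * 'Z_2 * 'Z_2 * 'Z_2 * 'Z_2 :=
  let: (i, j, m) := w in (i, j, 0, 1 - j, m, - m).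
have F_inj : injective F by move=> [[? ?] ?] [[? ?] ?] [-> -> _ ->].
have -> : Omega2 = F @: setT.
  apply/setP => -[[[[[i j] k] l] m] n]; rewrite inE.
  apply/and3P/imsetP =>
    [[/eqP-> /eqP mn /eqP jl]|[[[i' j'] m'] _ [_ -> -> -> -> ->]]].
    by exists (i, j, m); rewrite ?inE //= -jl addrC addKr; congr (_, _);
      apply/eqP; rewrite -addr_eq0 addrC mn.
  by rewrite subrKC subrr.
by rewrite card_imset // cardsT !card_prod !card_ord.
Qed.

Lemma card_Omega : #|Omega| = 24%N.
Proof.
rewrite cardsU card_Omega1 card_Omega2 (_ : _ :&: _ = set0) ?cards0 //.
apply/setP => -[[[[[i j] k] l] m] n]; rewrite !inE.
by have [->|] := eqVneq (m + n) 1; rewrite !(andbF, andFb).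
Qed.

Lemma dim2_index_card : #|dim2_index| = 56%N.
Proof.
by rewrite !card_sum !card_sig card_Omega card_Lambda1 card_Lambda2.
Qed.
End Cards.

Theorem theorem3p6 (K : closedFieldType) (charK : [pchar K] =i pred0)
    (xi : K) (xiP : 4.-primitive_root xi) :
  [/\ #|simple_index| = 88%N /\
      classification (fun M : lmodType (Dalg K) => simple_module M)
        (simple_family xiP),
      #|dim1_index| = 32%N /\
      classification
        (fun M : lmodType (Dalg K) => simple_module M /\ has_dim 1 M)
        (dim1_family xiP)
    & #|dim2_index| = 56%N /\
      classification
        (fun M : lmodType (Dalg K) => simple_module M /\ has_dim 2 M)
        (dim2_family xiP)].
Proof.
have dim1 w : has_dim 1 (dim1_family xiP w).
  by case: w => [[[i j] k] l]; apply: mxmod_has_dim.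
have dim2 w : has_dim 2 (dim2_family xiP w).
  by case: w => [[[[[[[[i j] k] l] m] n] O]|[[[[i j] k] l] L]]
    |[[[[i j] k] l] L]] /=; apply: mxmod_has_dim.
have listed N (simN : simple_module N) := simple_family_complete xiP simN.
split; split.
- by rewrite card_sum dim1_index_card dim2_index_card.
- split; [exact: simple_family_simple | exact: simple_family_inj | exact: listed].
- exact: dim1_index_card.
- split=> [w | w w' iso | N [simN dimN]].
  + by split=> //; apply: (simple_family_simple xiP (inl w)).
  + by case: (@simple_family_inj K xi xiP (inl w) (inl w') iso).
  + have [[w|w] iso] := listed N simN; first by exists w.
    by have := has_dim_uniq (has_dim_iso iso dimN) (dim2 w).
- exact: dim2_index_card.
- split=> [w | w w' iso | N [simN dimN]].
  + by split=> //; apply: (simple_family_simple xiP (inr w)).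
  + by case: (@simple_family_inj K xi xiP (inr w) (inr w') iso).
  + have [[w|w] iso] := listed N simN; last by exists w.
    by have := has_dim_uniq (has_dim_iso iso dimN) (dim1 w).
Qed.
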